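(* Let $(\mathcal V,\mathcal E)$ be a labeled random walk with finite or countable vertex set $\mathcal V$, label set $\Lambda$, $|\Lambda|=N$, and weights $(\alpha_{i,\lambda})$, and suppose that $$\sum_{i\in\mathcal V}(N-n_i)=\sum_{j\in\mathcal V}(N-n^j).$$ Let unitary matrices $C_i=[c_{i,\lambda}^k]$ ($i\in\mathcal V$) and a bijection $\varphi$ be chosen as in the context, with $F,G$ the components of $\varphi$ and $\tilde F,\tilde G$ the components of $\varphi^{-1}$. Write $i\xrightarrow{\lambda}j$ if there is an edge from $i$ to $j$ with label $\lambda$. Define the operators $(S_\lambda)_{\lambda\in\Lambda}$ on $\mathcal H=\ell^2[\mathcal V\times\Omega_N^*]$ by $$S_\lambda(j,w)=\begin{cases}\displaystyle\sum_{k=0}^{n_i-1}\overline{c_{i,\lambda}^k}\,(i,kw),&\text{if } i\xrightarrow{\lambda}j,\\ (F(j,\lambda),G(j,\lambda)w),&\text{otherwise.}\end{cases}$$ Then $(S_\lambda)_{\lambda\in\Lambda}$ is the Cuntz dilation of the row coisometry $(V_\lambda)_{\lambda\in\Lambda}$ associated to the random walk. Moreover, the adjoint operators are $$S_\lambda^*(i,k'w)=\begin{cases}\displaystyle\sum_{k=0}^{n_i-1}c_{i,\lambda}^k\,(j,k'w\setminus k),&\text{if } i\xrightarrow{\lambda}j,\\ (\tilde F(i,k'),w),&\text{if }\lambda=\tilde G(i,k'),\\ 0,&\text{otherwise.}\end{cases}$$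
   Context: A labeled random walk consists of: a directed graph with finite or countable vertex set $\mathcal V$; a label for each edge, from a finite set $\Lambda$, $|\Lambda|=N\ge2$, such that two different edges leaving the same vertex have different labels and different end vertices, and for each vertex and each label $\lambda$ at most one edge with label $\lambda$ comes into that vertex; and complex numbers $\alpha_{i,\lambda}$ with $\alpha_{i,\lambda}=0$ if there is no edge from $i$ with label $\lambda$, and $\sum_{\lambda\in\Lambda}|\alpha_{i,\lambda}|^2=1$ for every $i\in\mathcal V$. $\Lambda_i$ is the set of labels of edges leaving $i$, $\Lambda^j$ the set of labels of edges ending in $j$, $n_i=|\Lambda_i|$, $n^j=|\Lambda^j|$. For each $i$, $C_i=[c_{i,\lambda}^k]_{\lambda\in\Lambda_i}^{k=0,\dots,n_i-1}$ is a (not necessarily unique) unitary $n_i\times n_i$ matrix (rows indexed by $\lambda\in\Lambda_i$, columns by $k$) whose first column is $c_{i,\lambda}^0=\alpha_{i,\lambda}$. $\Omega_N^*$ is the set of finite words over $\{0,1,\dots,N-1\}$ not ending in $0$, including the empty word $\emptyset$. For a digit $k\in\{0,\dots,N-1\}$ and $w\in\Omega_N^*$, $kw$ is the concatenation, with the convention $0\emptyset=\emptyset$. For $w\in\Omega_N^*$ and a digit $k$, $w\setminus k=w'$ if $w=kw'$ with $w'\in\Omega_N^*$, and $w\setminus k=\mathbf{null}$ otherwise; by convention the vector $(i,\mathbf{null})$ is $0$. $\mathcal H=\ell^2[\mathcal V\times\Omega_N^*]$ has canonical orthonormal basis $(i,w)$, $i\in\mathcal V$, $w\in\Omega_N^*$;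 $\mathcal K=\ell^2[\mathcal V]$ is identified with the closed span of $\{(i,\emptyset):i\in\mathcal V\}$, $\vec i=\delta_i$ being identified with $(i,\emptyset)$. Under the assumed equality of the two sums, the sets $\{(j,\lambda):j\in\mathcal V,\lambda\in\Lambda\setminus\Lambda^j\}$ and $\{(i,k):i\in\mathcal V,n_i\le k\le N-1\}$ have the same cardinality; $\varphi$ is a bijection from the first onto the second, and $F=\pi_1\circ\varphi$, $G=\pi_2\circ\varphi$, $\tilde F=\pi_1\circ\varphi^{-1}$, $\tilde G=\pi_2\circ\varphi^{-1}$, with $\pi_1,\pi_2$ the projections onto the first and second components. The row coisometry associated to the random walk is $(V_\lambda)_{\lambda\in\Lambda}$ on $\mathcal K$ with $V_\lambda^*\vec i=\alpha_{i,\lambda}\vec j$ if there is an edge from $i$ to $j$ with label $\lambda$, and $V_\lambda^*\vec i=0$ otherwise (row coisometry means $\sum_{\lambda}V_\lambda V_\lambda^*=I_{\mathcal K}$). $(S_\lambda)$ is the Cuntz dilation of $(V_\lambda)$ (unique up to unitary equivalence) if: $S_\lambda^*S_{\lambda'}=\delta_{\lambda\lambda'}I$, $\sum_\lambda S_\lambda S_\lambda^*=I$ on $\mathcal H\supseteq\mathcal K$; $S_\lambda^*\mathcal K\subseteq\mathcal K$ and $S_\lambda^*|_{\mathcal K}=V_\lambda^*$ for all $\lambda$; and $\mathcal K$ is cyclic, i.e. the closed span of all $S_{\lambda_1}\cdots S_{\lambda_p}\mathcal K$, $\lambda_1,\dots,\lambda_p\in\Lambda$, $p\ge0$, is $\mathcal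 H$.
   Formalization: In the adjoint formula the first two cases can overlap with different values; the formal statement lets the case λ = G̃(i,k′), read with n_i ≤ k′ ≤ N−1, take precedence over the case of an edge from i to j labeled λ. *)

(* Defs.v *)
From HB Require Import structures.
From mathcomp Require Import all_boot all_order all_algebra.
From mathcomp Require Import complex.
From mathcomp Require Import all_classical all_reals all_analysis.
From mathcomp Require Import ring lra.

Set Implicit Arguments.
Unset Strict Implicit.
Unset Printing Implicit Defensive.

Import Order.TTheory GRing.Theory Num.Theory numFieldNormedType.Exports.

Local Open Scope classical_set_scope.
Local Open Scope ring_scope.

Section modulus.
Context {R : realType}.
Implicit Types z w : R[i].

Definition cmod z : R := complex.Re `|z|.

Lemma cmodE z : (cmod z)%:C%C = `|z|.
Proof. by rewrite /cmod; apply: RRe_real; exact: normr_real. Qed.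

Lemma cmod_ge0 z : 0 <= cmod z.
Proof. by have := normr_ge0 z; rewrite -cmodE lecR. Qed.

Lemma cmodM z w : cmod (z * w) = cmod z * cmod w.
Proof. by apply: complexI; rewrite rmorphM /= !cmodE normrM. Qed.

Lemma cmodD z w : cmod (z + w) <= cmod z + cmod w.
Proof. by have := ler_normD z w; rewrite -!cmodE -rmorphD lecR. Qed.

Lemma cmod0 : cmod 0 = 0.
Proof. by apply: complexI; rewrite cmodE normr0. Qed.

Lemma cmod1 : cmod 1 = 1.
Proof. by apply: complexI; rewrite cmodE normr1. Qed.

Lemma cmod0_eq0 z : cmod z = 0 -> z = 0.
Proof. by move=> z0; apply/eqP; rewrite -normr_eq0 -cmodE z0. Qed.

Lemma cmod_conj z : cmod z^* = cmod z.
Proof. by apply: complexI; rewrite !cmodE norm_conjC. Qed.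

Lemma cmodsq z : cmod z ^+ 2 = complex.Re z ^+ 2 + complex.Im z ^+ 2.
Proof.
by rewrite /cmod normc_def /= sqr_sqrtr // addr_ge0 // sqr_ge0.
Qed.

Lemma Re_cmod z : `|complex.Re z| <= cmod z.
Proof.
rewrite -(@ler_pXn2r _ 2) ?nnegrE ?cmod_ge0 // cmodsq real_normK ?num_real //.
by rewrite lerDl sqr_ge0.
Qed.

Lemma Im_cmod z : `|complex.Im z| <= cmod z.
Proof.
rewrite -(@ler_pXn2r _ 2) ?nnegrE ?cmod_ge0 // cmodsq real_normK ?num_real //.
by rewrite lerDr sqr_ge0.
Qed.

Lemma cmod_ReIm z : cmod z <= `|complex.Re z| + `|complex.Im z|.
Proof.
rewrite -(@ler_pXn2r _ 2) ?nnegrE ?cmod_ge0 ?addr_ge0 // cmodsq sqrrD.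
rewrite !real_normK ?num_real // lerD2r lerDl.
by rewrite mulrn_wge0 // mulr_ge0.
Qed.

End modulus.

Section finite_sums.
Context {R : realType} {X : Type}.
Implicit Types (s : seq X) (a b : X -> R).

Lemma cauchy_schwarz_seq s a b :
  (\sum_(x <- s) a x * b x) ^+ 2
    <= (\sum_(x <- s) a x ^+ 2) * (\sum_(x <- s) b x ^+ 2).
Proof.
set P := \sum_(x <- s) a x * b x; set A := \sum_(x <- s) a x ^+ 2.
set B := \sum_(x <- s) b x ^+ 2.
have A0 : 0 <= A by apply: sumr_ge0 => x _; exact: sqr_ge0.
have B0 : 0 <= B by apply: sumr_ge0 => x _; exact: sqr_ge0.
have H u v : 0 <= u ^+ 2 * A + u * v *+ 2 * P + v ^+ 2 * B.
  rewrite /A /B /P !big_distrr -!big_split /=; apply: sumr_ge0 => x _.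
  rewrite (_ : _ + _ = (u * a x + v * b x) ^+ 2) ?sqr_ge0 //.
  by ring.
have [B1|] := ltP 0 B.
  have := H B (- P).
  rewrite (_ : _ + _ = B * (A * B - P ^+ 2)); last by ring.
  by rewrite pmulr_rge0 // subr_ge0.
move=> B1; have {B0 B1}B1 : B = 0 by apply/eqP; rewrite eq_le B0 B1.
have [A1|] := ltP 0 A.
  have := H (- P) A.
  rewrite (_ : _ + _ = A * (A * B - P ^+ 2)); last by ring.
  by rewrite pmulr_rge0 // subr_ge0.
move=> A1; have {A0 A1}A1 : A = 0 by apply/eqP; rewrite eq_le A0 A1.
have := H 1 1; have := H 1 (- 1); rewrite A1 B1 => h1 h2.
have -> : P = 0 by lra.
by rewrite mulr0 expr0n.
Qed.

Lemma minkowski_seq s a b :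
  (forall x, 0 <= a x) -> (forall x, 0 <= b x) ->
  \sum_(x <- s) (a x + b x) ^+ 2 <=
  (Num.sqrt (\sum_(x <- s) a x ^+ 2) + Num.sqrt (\sum_(x <- s) b x ^+ 2)) ^+ 2.
Proof.
move=> a0 b0.
have A0 : 0 <= \sum_(x <- s) a x ^+ 2 by apply: sumr_ge0 => x _; exact: sqr_ge0.
have B0 : 0 <= \sum_(x <- s) b x ^+ 2 by apply: sumr_ge0 => x _; exact: sqr_ge0.
rewrite sqrrD !sqr_sqrtr // -sqrtrM //.
under eq_bigr do rewrite sqrrD.
rewrite !big_split /= lerD2r lerD2l -mulr2n lerMn2r /=.
rewrite -[leLHS]ger0_norm; last by apply: sumr_ge0 => x _; rewrite mulr_ge0.
rewrite -sqrtr_sqr ler_sqrt ?mulr_ge0 //.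
exact: cauchy_schwarz_seq.
Qed.

End finite_sums.

Section nonneg_sums.
Context {R : realType} {X : choiceType}.
Implicit Types (s : seq X) (a b : X -> R).

Lemma ge_esum_seq a s : uniq s -> (forall x, 0 <= a x) ->
  ((\sum_(x <- s) a x)%:E <= \esum_(x in [set: X]) (a x)%:E)%E.
Proof.
move=> us a0; apply: esum_ge; exists [set` s] => //.
by rewrite -fsbig_seq // sumEFin.
Qed.

Lemma esum_le_seq a (M : R) :
  (forall s, uniq s -> \sum_(x <- s) a x <= M) ->
  (\esum_(x in [set: X]) (a x)%:E <= M%:E)%E.
Proof.
move=> H; apply: ge_ereal_sup => _ [A [finA _] <-].
by rewrite fsbig_finite // sumEFin lee_fin H // finmap.fset_uniq.
Qed.

Lemma esum_EFin_fin_num a : (forall x, 0 <= a x) ->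
  (\esum_(x in [set: X]) (a x)%:E < +oo)%E ->
  (\esum_(x in [set: X]) (a x)%:E)%E \is a fin_num.
Proof.
move=> a0 aoo; rewrite ge0_fin_numE //; apply: esum_ge0 => x _.
by rewrite lee_fin.
Qed.

End nonneg_sums.

Section ell2.
Context {R : realType} {X : choiceType}.
Implicit Types f g : X -> R[i].

Definition sqsum f : \bar R := (\esum_(x in [set: X]) ((cmod (f x) ^+ 2)%:E))%E.

Definition sqsummable : {pred X -> R[i]} := fun f => (sqsum f < +oo)%E.

Let sqsum_ge s f : uniq s ->
  ((\sum_(x <- s) cmod (f x) ^+ 2)%:E <= sqsum f)%E.
Proof. by move=> us; apply: ge_esum_seq => // x; exact: sqr_ge0. Qed.

Lemma sqsum_ge0 f : (0 <= sqsum f)%E.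
Proof. by apply: esum_ge0 => x _; rewrite lee_fin sqr_ge0. Qed.

Lemma sqsum_fin f : f \in sqsummable -> sqsum f \is a fin_num.
Proof. by move=> fX; rewrite ge0_fin_numE // sqsum_ge0. Qed.

Lemma sqsum_seq f : f \in sqsummable -> forall s, uniq s ->
  \sum_(x <- s) cmod (f x) ^+ 2 <= fine (sqsum f).
Proof.
by move=> fX s us; rewrite -lee_fin fineK ?sqsum_fin // sqsum_ge.
Qed.

Lemma sqsum_le f M : (forall s, uniq s -> \sum_(x <- s) cmod (f x) ^+ 2 <= M) ->
  f \in sqsummable /\ fine (sqsum f) <= M.
Proof.
move=> H.
have le_fM : (sqsum f <= M%:E)%E by apply: esum_le_seq.
have fX : f \in sqsummable by exact: le_lt_trans le_fM (ltry _).
by split=> //; rewrite -lee_fin fineK ?sqsum_fin.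
Qed.

Lemma sqsumZ (a : R[i]) f : f \in sqsummable ->
  a *: f \in sqsummable /\ fine (sqsum (a *: f)) <= cmod a ^+ 2 * fine (sqsum f).
Proof.
move=> fX; apply: sqsum_le => s us.
under eq_bigr do rewrite /= cmodM exprMn.
by rewrite -big_distrr /= ler_wpM2l ?sqr_ge0 // sqsum_seq.
Qed.

Lemma sqsumD f g : f \in sqsummable -> g \in sqsummable ->
  f + g \in sqsummable /\
  fine (sqsum (f + g)) <=
    (Num.sqrt (fine (sqsum f)) + Num.sqrt (fine (sqsum g))) ^+ 2.
Proof.
move=> fX gX; apply: sqsum_le => s us.
apply: le_trans (_ : \sum_(x <- s) (cmod (f x) + cmod (g x)) ^+ 2 <= _).
  apply: ler_sum => x _; rewrite ler_pXn2r ?nnegrE ?addr_ge0 ?cmod_ge0 //.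
  exact: cmodD.
apply: le_trans (minkowski_seq _ _ _) _; try by move=> x; exact: cmod_ge0.
rewrite ler_pXn2r ?nnegrE ?addr_ge0 ?sqrtr_ge0 //.
by apply: lerD; rewrite ler_wsqrtr // sqsum_seq.
Qed.

Lemma sqsummable_submod_closed : submod_closed sqsummable.
Proof.
split=> [|a f g fX gX].
  apply: (sqsum_le (M := 0) _).1 => s _.
  by rewrite big1 // => x _; rewrite cmod0 expr0n.
exact: (sqsumD (sqsumZ a fX).1 gX).1.
Qed.

HB.instance Definition _ := GRing.isSubmodClosed.Build _ _ sqsummable
  sqsummable_submod_closed.

Record ell2 := Ell2 { ell2_fun :> X -> R[i]; ell2_sqsummable : ell2_fun \in sqsummable }.

HB.instance Definition _ := [isSub for ell2_fun].
HB.instance Definition _ := [Choice of ell2 by <:].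
HB.instance Definition _ := [SubChoice_isSubLmodule of ell2 by <:].

End ell2.

Arguments ell2 R X%_type : clear implicits.
Arguments Ell2 {R X} ell2_fun ell2_sqsummable.

Section ell2_norm.
Context {R : realType} {X : choiceType}.
Implicit Types f g : ell2 R X.

Lemma ell2P f g : f =1 g -> f = g.
Proof. by move=> fg; apply: val_inj; apply/funext. Qed.

Lemma ell2D f g x : (f + g) x = f x + g x. Proof. by []. Qed.
Lemma ell2B f g x : (f - g) x = f x - g x. Proof. by []. Qed.
Lemma ell2Z (a : R[i]) f x : (a *: f) x = a * f x. Proof. by []. Qed.
Lemma ell20 x : (0 : ell2 R X) x = 0. Proof. by []. Qed.

Lemma ell2_sum I (r : seq I) (F : I -> ell2 R X) x :
  (\sum_(i <- r) F i) x = \sum_(i <- r) F i x.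
Proof. by elim/big_rec2 : _ => // i y z _ <-. Qed.

Definition norm2 f : R := Num.sqrt (fine (sqsum f)).

Lemma norm2_ge0 f : 0 <= norm2 f. Proof. exact: sqrtr_ge0. Qed.

Lemma norm2sq f : norm2 f ^+ 2 = fine (sqsum f).
Proof. by rewrite sqr_sqrtr // fine_ge0 // sqsum_ge0. Qed.

Lemma norm2_seq f s : uniq s -> \sum_(x <- s) cmod (f x) ^+ 2 <= norm2 f ^+ 2.
Proof. by move=> us; rewrite norm2sq sqsum_seq // ell2_sqsummable. Qed.

Lemma norm2_le f M : 0 <= M ->
  (forall s, uniq s -> \sum_(x <- s) cmod (f x) ^+ 2 <= M ^+ 2) -> norm2 f <= M.
Proof.
move=> M0 /sqsum_le[_ H].
by rewrite -(@ler_pXn2r _ 2) ?nnegrE ?norm2_ge0 // norm2sq.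
Qed.

Lemma norm2D f g : norm2 (f + g) <= norm2 f + norm2 g.
Proof.
rewrite -(@ler_pXn2r _ 2) ?nnegrE ?addr_ge0 ?norm2_ge0 // norm2sq.
exact: (sqsumD (ell2_sqsummable f) (ell2_sqsummable g)).2.
Qed.

Lemma norm2Z_le (a : R[i]) f : norm2 (a *: f) <= cmod a * norm2 f.
Proof.
rewrite -(@ler_pXn2r _ 2) ?nnegrE ?mulr_ge0 ?norm2_ge0 ?cmod_ge0 //.
by rewrite exprMn !norm2sq (sqsumZ a (ell2_sqsummable f)).2.
Qed.

Lemma norm2Z (a : R[i]) f : norm2 (a *: f) = cmod a * norm2 f.
Proof.
apply/eqP; rewrite eq_le norm2Z_le /=.
have [->|a0] := eqVneq a 0; first by rewrite cmod0 mul0r norm2_ge0.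
have := norm2Z_le a^-1 (a *: f).
rewrite scalerA mulVf // scale1r => /(ler_wpM2l (cmod_ge0 a)).
by rewrite mulrA -cmodM mulfV // cmod1 mul1r.
Qed.

Lemma norm2_eq0 f : norm2 f = 0 -> f = 0.
Proof.
move=> f0; apply: ell2P => x; apply: cmod0_eq0; apply/eqP.
rewrite -(sqrf_eq0 (cmod (f x))) eq_le sqr_ge0 andbT.
by have := norm2_seq f (isT : uniq [:: x]); rewrite big_seq1 f0 expr0n.
Qed.

(* Norms of [normedModType R[i]] take their values in [R[i]]. *)
Definition ell2_norm f : R[i] := (norm2 f)%:C%C.

Fact ell2_normD f g : ell2_norm (f + g) <= ell2_norm f + ell2_norm g.
Proof. by rewrite /ell2_norm -rmorphD lecR norm2D. Qed.

Fact ell2_normZ (a : R[i]) f : ell2_norm (a *: f) = `|a| * ell2_norm f.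
Proof. by rewrite /ell2_norm norm2Z rmorphM -cmodE. Qed.

Fact ell2_norm_eq0 f : ell2_norm f = 0 -> f = 0.
Proof. by move=> /complexI; exact: norm2_eq0. Qed.

HB.instance Definition _ := Lmodule_isNormed.Build R[i] (ell2 R X)
  ell2_normD ell2_normZ ell2_norm_eq0.

Lemma norm2E f : `|f| = (norm2 f)%:C%C. Proof. by []. Qed.

End ell2_norm.

Section basis.
Context {R : realType} {X : choiceType}.

Let delta_fun (x : X) : X -> R[i] := fun y => (y == x)%:R.

Let sum_delta_le s x : uniq s -> \sum_(y <- s) cmod (delta_fun x y) ^+ 2 <= 1.
Proof.
move=> us; have [xs|xs] := boolP (x \in s).
  rewrite (bigD1_seq x) //= /delta_fun eqxx cmod1 expr1n big1 ?addr0 // => y yx.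
  by rewrite (negbTE yx) cmod0 expr0n.
rewrite big_seq big1 // => y ys; rewrite /delta_fun.
have /negbTE -> : y != x by apply: contraNneq xs => <-.
by rewrite cmod0 expr0n.
Qed.

Fact delta_sqsummable x : delta_fun x \in sqsummable.
Proof. exact: (sqsum_le (fun s us => sum_delta_le x us)).1. Qed.

Definition delta (x : X) : ell2 R X := Ell2 (delta_fun x) (delta_sqsummable x).

Lemma deltaE x y : delta x y = (y == x)%:R. Proof. by []. Qed.

Definition trunc (b : X -> R[i]) (s : seq X) : ell2 R X :=
  \sum_(x <- s) b x *: delta x.

Lemma truncE b s y : uniq s -> trunc b s y = if y \in s then b y else 0.
Proof.
move=> us; rewrite /trunc ell2_sum; case: ifPn => ys.
  rewrite (bigD1_seq y) // ell2Z deltaE eqxx mulr1 big1 => [|z zy].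
    exact: addr0.
  by rewrite ell2Z deltaE eq_sym (negbTE zy) mulr0.
rewrite big_seq big1 // => z zs; rewrite ell2Z deltaE.
have /negbTE -> : y != z by apply: contraNneq ys => ->.
by rewrite mulr0.
Qed.

Lemma sum_seqI (a : X -> R) s t : uniq s -> uniq t -> (forall x, 0 <= a x) ->
  \sum_(x <- t) (if x \in s then a x else 0) <= \sum_(x <- s) a x.
Proof.
move=> us ut a0; rewrite -big_mkcond /= -big_filter.
rewrite (perm_big [seq x <- s | x \in t]) /=; last first.
  apply: uniq_perm; rewrite ?filter_uniq // => x.
  by rewrite !mem_filter /= andbC.
by rewrite big_filter big_mkcond; apply: ler_sum => x _; case: ifP.
Qed.

Lemma norm2_trunc b s : uniq s ->
  norm2 (trunc b s) ^+ 2 = \sum_(x <- s) cmod (b x) ^+ 2.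
Proof.
move=> us; apply/eqP; rewrite eq_le; apply/andP; split.
  rewrite norm2sq; apply: (sqsum_le _).2 => t ut.
  apply: le_trans (sum_seqI us ut _) => [|x]; last exact: sqr_ge0.
  apply: ler_sum => x _; rewrite truncE //; case: ifP => //.
  by rewrite cmod0 expr0n.
apply: le_trans (norm2_seq _ us); rewrite [leLHS]big_seq [leRHS]big_seq.
by apply: ler_sum => x xs; rewrite truncE // xs.
Qed.

Lemma trunc_approx (f : ell2 R X) e : 0 < e ->
  exists2 s, uniq s & norm2 (f - trunc f s) <= e.
Proof.
move=> e0.
have [s us Hs] : exists2 s, uniq s &
    norm2 f ^+ 2 - e ^+ 2 <= \sum_(x <- s) cmod (f x) ^+ 2.
  apply: contrapT => H.
  have : norm2 f ^+ 2 <= norm2 f ^+ 2 - e ^+ 2.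
    rewrite {1}norm2sq; apply: (sqsum_le _).2 => s us.
    rewrite leNgt; apply/negP => /ltW Hs; apply: H; exists s => //.
  by rewrite lerBrDr gerDl leNgt exprn_gt0.
exists s => //; apply: norm2_le; first exact: ltW.
move=> t ut.
have us' : uniq (s ++ [seq x <- t | x \notin s]).
  rewrite cat_uniq us filter_uniq // andbT /=; apply/hasPn => x.
  by rewrite mem_filter => /andP[].
have := norm2_seq f us'; rewrite big_cat /= big_filter.
rewrite (_ : \sum_(x <- t) cmod ((f - trunc f s) x) ^+ 2 =
             \sum_(x <- t | x \notin s) cmod (f x) ^+ 2).
  by lra.
rewrite [RHS]big_mkcond; apply: eq_bigr => x _.
rewrite ell2B truncE //; case: ifP => xs; rewrite ?subrr ?cmod0 ?expr0n //=.
by rewrite subr0.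
Qed.

End basis.

Section summable_families.
Context {R : realType} {X : choiceType}.
Implicit Types (a b h k : X -> R).

Local Notation S a := (\esum_(x in [set: X]) (a x)%:E)%E.

Definition abs_summable h := (S (fun x => `|h x|) < +oo)%E.

(* Sum of an absolutely summable family: positive part minus negative part. *)
Definition rsum h : R :=
  fine (\esum_(x in [set: X]) (EFin \o h)^\+%E x -
        \esum_(x in [set: X]) (EFin \o h)^\-%E x)%E.

Let summableP a : (forall x, 0 <= a x) -> (S a < +oo)%E ->
  esum.summable [set: X] (EFin \o a).
Proof.
move=> a0 aoo; rewrite /esum.summable (eq_esum (b := EFin \o a)) // => x _ /=.
by rewrite ger0_norm.
Qed.

Let SD a b : (forall x, 0 <= a x) -> (forall x, 0 <= b x) ->
  (S (fun x => (a x + b x)%R) = S a + S b)%E.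
Proof. by move=> a0 b0; rewrite -esumD // => x _; rewrite lee_fin. Qed.

Let SZ r a : 0 <= r -> (forall x, 0 <= a x) -> (S a < +oo)%E ->
  (S (fun x => (r * a x)%R) = r%:E * S a)%E.
Proof.
move=> r0 a0 aoo; have aS := esum_EFin_fin_num a0 aoo.
have H t b : 0 <= t -> (forall x, 0 <= b x) -> (S b < +oo)%E ->
    (S (fun x => (t * b x)%R) <= t%:E * S b)%E.
  move=> t0 b0 boo; have bS := esum_EFin_fin_num b0 boo.
  rewrite -(fineK bS) -EFinM; apply: esum_le_seq => s us.
  by rewrite -big_distrr ler_wpM2l // -lee_fin fineK // ge_esum_seq.
apply/eqP; rewrite eq_le H //=.
have [->|rn0] := eqVneq r 0.
  by rewrite mul0e; apply: esum_ge0 => x _; rewrite mul0r.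
have r_gt0 : 0 < r by rewrite lt_neqAle eq_sym rn0.
have raoo : (S (fun x => (r * a x)%R) < +oo)%E.
  by apply: le_lt_trans (H _ _ r0 a0 aoo) _; rewrite -(fineK aS) -EFinM ltry.
have ra0 x : 0 <= r * a x by rewrite mulr_ge0.
have := H r^-1 _ _ ra0 raoo; rewrite invr_ge0 => /(_ r0).
under eq_esum do rewrite mulrA mulVf // mul1r.
move=> /(lee_wpmul2l (_ : (0 <= r%:E)%E)); rewrite lee_fin => /(_ r0).
by rewrite muleA -EFinM mulfV // mul1e.
Qed.

Let S_le a b : (forall x, a x <= b x) -> (S a <= S b)%E.
Proof. by move=> ab; apply: le_esum => x _; rewrite lee_fin. Qed.

Lemma rsumB a b : (forall x, 0 <= a x) -> (forall x, 0 <= b x) ->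
  (S a < +oo)%E -> (S b < +oo)%E ->
  rsum (fun x => a x - b x) = fine (S a) - fine (S b).
Proof.
move=> a0 b0 aoo boo; rewrite /rsum.
rewrite -[EFin \o _]/((EFin \o a) \- (EFin \o b))%E esumB; first last.
- by move=> x _; rewrite lee_fin.
- by move=> x _; rewrite lee_fin.
- exact: summableP.
- exact: summableP.
by rewrite fineB // esum_EFin_fin_num.
Qed.

Let posp h x := Num.max (h x) 0.
Let negp h x := Num.max (- h x) 0.

Let posp0 h x : 0 <= posp h x. Proof. by rewrite le_max lexx orbT. Qed.
Let negp0 h x : 0 <= negp h x. Proof. by rewrite le_max lexx orbT. Qed.
Let pos_neg h x : h x = posp h x - negp h x.
Proof.
have [h0|h0] := leP 0 (h x); rewrite /posp /negp.
  by rewrite max_l // max_r ?oppr_le0 // subr0.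
by rewrite max_r ?(ltW h0) // max_l ?oppr_ge0 ?(ltW h0) // sub0r opprK.
Qed.
Let posoo h : abs_summable h -> (S (posp h) < +oo)%E.
Proof.
apply: le_lt_trans; apply: S_le => x.
by rewrite ge_max ler_norm normr_ge0.
Qed.
Let negoo h : abs_summable h -> (S (negp h) < +oo)%E.
Proof.
apply: le_lt_trans; apply: S_le => x.
by rewrite ge_max -normrN ler_norm normr_ge0.
Qed.

Let rsumE h : abs_summable h -> rsum h = fine (S (posp h)) - fine (S (negp h)).
Proof.
move=> hX; rewrite -rsumB //; [|exact: posoo|exact: negoo].
by congr rsum; apply/funext => x; rewrite -pos_neg.
Qed.

Let Sfin h : abs_summable h -> S (fun x => `|h x|) \is a fin_num.
Proof. by move=> hX; apply: esum_EFin_fin_num. Qed.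

Lemma abs_summableD h k : abs_summable h -> abs_summable k ->
  abs_summable (fun x => h x + k x).
Proof.
move=> hX kX; apply: le_lt_trans (lte_add_pinfty hX kX).
by rewrite -SD //; apply: S_le => x; exact: ler_normD.
Qed.

Lemma abs_summableZ r h : abs_summable h -> abs_summable (fun x => r * h x).
Proof.
move=> hX; rewrite /abs_summable.
under eq_esum do rewrite normrM.
by rewrite SZ // -(fineK (Sfin hX)) -EFinM ltry.
Qed.

Lemma abs_summable_le h a : (forall x, `|h x| <= a x) -> (S a < +oo)%E ->
  abs_summable h.
Proof. by move=> ha; apply: le_lt_trans; apply: S_le. Qed.

Lemma rsumD h k : abs_summable h -> abs_summable k ->
  rsum (fun x => h x + k x) = rsum h + rsum k.
Proof.
move=> hX kX; rewrite (rsumE hX) (rsumE kX).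
rewrite (_ : (fun x => _) = fun x => (posp h x + posp k x) - (negp h x + negp k x)).
  have [hp hn kp kn] := And4 (posoo hX) (negoo hX) (posoo kX) (negoo kX).
  rewrite rsumB; try by move=> x; rewrite addr_ge0.
  - rewrite !SD // !fineD ?esum_EFin_fin_num //; by ring.
  - by rewrite SD // lte_add_pinfty.
  - by rewrite SD // lte_add_pinfty.
by apply/funext => x; rewrite (pos_neg h) (pos_neg k); ring.
Qed.

Lemma rsumZ r h : abs_summable h -> rsum (fun x => r * h x) = r * rsum h.
Proof.
move=> hX; rewrite (rsumE hX).
have [hp hn] := conj (posoo hX) (negoo hX).
have Soo t a : 0 <= t -> (forall x, 0 <= a x) -> (S a < +oo)%E ->
    (S (fun x => (t * a x)%R) < +oo)%E.
  move=> t0 a0 aoo.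
  by rewrite SZ // -(fineK (esum_EFin_fin_num a0 aoo)) -EFinM ltry.
have [r0|r0] := leP 0 r.
  rewrite (_ : (fun x => _) = fun x => r * posp h x - r * negp h x); last first.
    by apply/funext => x; rewrite {1}(pos_neg h) mulrBr.
  rewrite rsumB; try by move=> x; rewrite mulr_ge0.
  - by rewrite !SZ // !fineM ?esum_EFin_fin_num //= mulrBr.
  - exact: Soo.
  - exact: Soo.
have Nr0 : 0 <= - r by rewrite oppr_ge0 ltW.
rewrite (_ : (fun x => _) = fun x => (- r) * negp h x - (- r) * posp h x); last first.
  by apply/funext => x; rewrite {1}(pos_neg h); ring.
rewrite rsumB; try by move=> x; rewrite mulr_ge0.
- by rewrite !SZ // !fineM ?esum_EFin_fin_num //=; ring.
- exact: Soo.
- exact: Soo.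
Qed.

Lemma rsum_le h : abs_summable h -> `|rsum h| <= fine (S (fun x => `|h x|)).
Proof.
move=> hX; rewrite (rsumE hX).
have P : fine (S (posp h)) <= fine (S (fun x => `|h x|)).
  rewrite fine_le ?Sfin ?esum_EFin_fin_num //; first exact: posoo.
  by apply: S_le => x; rewrite ge_max ler_norm normr_ge0.
have N : fine (S (negp h)) <= fine (S (fun x => `|h x|)).
  rewrite fine_le ?Sfin ?esum_EFin_fin_num //; first exact: negoo.
  by apply: S_le => x; rewrite ge_max -normrN ler_norm normr_ge0.
have P0 : 0 <= fine (S (posp h)).
  by rewrite fine_ge0 // esum_ge0 // => x _; rewrite lee_fin.
have N0 : 0 <= fine (S (negp h)).
  by rewrite fine_ge0 // esum_ge0 // => x _; rewrite lee_fin.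
by rewrite ler_norml; apply/andP; split; lra.
Qed.

Lemma rsum_ge0 a : (forall x, 0 <= a x) -> (S a < +oo)%E -> rsum a = fine (S a).
Proof.
move=> a0 aoo.
have Z : S (fun=> 0) = 0%E :> \bar R by apply: esum1.
rewrite -[RHS]subr0 -[0 in RHS]/(fine 0%E) -Z -rsumB ?Z //.
by congr rsum; apply/funext => x; rewrite subr0.
Qed.

Lemma rsum_finite h s : uniq s -> (forall x, x \notin s -> h x = 0) ->
  rsum h = \sum_(x <- s) h x.
Proof.
move=> us h0.
have F a : (forall x, 0 <= a x) -> (forall x, x \notin s -> a x = 0) ->
    S a = (\sum_(x <- s) a x)%:E.
  move=> a0 as0; apply/eqP; rewrite eq_le ge_esum_seq // andbT.
  apply: esum_le_seq => t ut; apply: le_trans (sum_seqI us ut a0).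
  by apply: ler_sum => x _; case: ifPn => // /as0 ->.
have hX : abs_summable h.
  rewrite /abs_summable F ?ltry // => x xs.
  by rewrite h0 // normr0.
rewrite rsumE // !F //=.
- by rewrite -sumrB; apply: eq_bigr => x _; rewrite -pos_neg.
- by move=> x xs; rewrite /negp h0 // oppr0 maxxx.
- by move=> x xs; rewrite /posp h0 // maxxx.
Qed.

End summable_families.

Section complex_sums.
Context {R : realType} {X : choiceType}.
Implicit Types h k : X -> R[i].

Definition csummable h :=
  (\esum_(x in [set: X]) (cmod (h x))%:E < +oo)%E.

Definition csum h : R[i] :=
  Complex (rsum (fun x => complex.Re (h x))) (rsum (fun x => complex.Im (h x))).

Let ReX h : csummable h -> abs_summable (fun x => complex.Re (h x)).
Proof. by apply: abs_summable_le => x; exact: Re_cmod. Qed.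
Let ImX h : csummable h -> abs_summable (fun x => complex.Im (h x)).
Proof. by apply: abs_summable_le => x; exact: Im_cmod. Qed.

Lemma csumD h k : csummable h -> csummable k ->
  csum (fun x => h x + k x) = csum h + csum k.
Proof.
move=> hX kX; apply/eqP; rewrite eq_complex /= -!rsumD; first last.
- exact: ReX.
- exact: ReX.
- exact: ImX.
- exact: ImX.
by apply/andP; split; apply/eqP; congr rsum; apply/funext => x; rewrite raddfD.
Qed.

Lemma csumZ (c : R[i]) h : csummable h -> csum (fun x => c * h x) = c * csum h.
Proof.
move=> hX; apply/eqP; rewrite eq_complex; case: c => a b /=.
have [re im] := conj (ReX hX) (ImX hX).
rewrite -[a * rsum _]rsumZ // -[a * rsum _]rsumZ // -[b * rsum _]rsumZ //.
rewrite -[b * rsum _]rsumZ // -[- rsum _]mulN1r -rsumZ; last exact: abs_summableZ.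
have Z u p : abs_summable p -> abs_summable (fun x : X => u * p x).
  exact: abs_summableZ.
rewrite -!rsumD; [|exact: Z|exact: Z|exact: Z|exact/Z/Z].
apply/andP; split; apply/eqP; congr rsum; apply/funext => x.
  by case: (h x) => u v /=; ring.
by case: (h x) => u v /=; ring.
Qed.

Lemma csum_conj h : csummable h -> csum (fun x => (h x)^*) = (csum h)^*.
Proof.
move=> hX; apply/eqP; rewrite eq_complex /= -mulN1r -rsumZ; last exact: ImX.
by apply/andP; split; apply/eqP; congr rsum; apply/funext => x;
  case: (h x) => u v //=; rewrite mulN1r.
Qed.

Lemma csum_le h : csummable h ->
  cmod (csum h) <= 2 * fine (\esum_(x in [set: X]) (cmod (h x))%:E)%E.
Proof.
move=> hX; apply: le_trans (cmod_ReIm _) _ => /=.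
have F (p : X -> R) : (forall x, `|p x| <= cmod (h x)) ->
    `|rsum p| <= fine (\esum_(x in [set: X]) (cmod (h x))%:E)%E.
  move=> ph; have pX := abs_summable_le ph hX.
  apply: le_trans (rsum_le pX) _; apply: fine_le.
  - by apply: esum_EFin_fin_num.
  - by apply: esum_EFin_fin_num => // x; exact: cmod_ge0.
  - by apply: le_esum => x _; rewrite lee_fin.
rewrite mulr_natl mulr2n lerD // F // => x; first exact: Re_cmod.
exact: Im_cmod.
Qed.

Lemma csum_finite h s : uniq s -> (forall x, x \notin s -> h x = 0) ->
  csum h = \sum_(x <- s) h x.
Proof.
move=> us h0; rewrite /csum !(@rsum_finite _ _ _ s) //; try by move=> x /h0 ->.
by apply/eqP; rewrite eq_complex !raddf_sum /= !eqxx.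
Qed.

End complex_sums.

Section inner_product.
Context {R : realType} {X : choiceType}.
Implicit Types f g h : ell2 R X.

(* Linear in the first argument, conjugate-linear in the second. *)
Definition dot f g : R[i] := csum (fun x => f x * (g x)^*).

Let dot_le f g s : uniq s ->
  \sum_(x <- s) cmod (f x * (g x)^*) <= norm2 f * norm2 g.
Proof.
move=> us; under eq_bigr do rewrite cmodM cmod_conj.
rewrite -(@ler_pXn2r _ 2) ?nnegrE ?mulr_ge0 ?norm2_ge0 //; last first.
  by apply: sumr_ge0 => x _; rewrite mulr_ge0 // cmod_ge0.
apply: le_trans (cauchy_schwarz_seq _ _ _) _.
rewrite exprMn ler_pM ?norm2_seq //; apply: sumr_ge0 => x _; exact: sqr_ge0.
Qed.

Lemma dot_summable f g : csummable (fun x => f x * (g x)^*).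
Proof.
apply: le_lt_trans (ltry (norm2 f * norm2 g)).
by apply: esum_le_seq => s us; exact: dot_le.
Qed.

Lemma dotDl f g h : dot (f + g) h = dot f h + dot g h.
Proof.
rewrite /dot -csumD; try exact: dot_summable.
by congr csum; apply/funext => x; rewrite ell2D mulrDl.
Qed.

Lemma dotZl (c : R[i]) f g : dot (c *: f) g = c * dot f g.
Proof.
rewrite /dot -csumZ; last exact: dot_summable.
by congr csum; apply/funext => x; rewrite ell2Z mulrA.
Qed.

Lemma dotC f g : dot g f = (dot f g)^*.
Proof.
rewrite /dot -csum_conj; last exact: dot_summable.
by congr csum; apply/funext => x; rewrite rmorphM /= conjCK mulrC.
Qed.

Lemma dotDr f g h : dot h (f + g) = dot h f + dot h g.
Proof. by rewrite !(dotC _ h) dotDl rmorphD. Qed.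

Lemma dotZr (c : R[i]) f g : dot f (c *: g) = c^* * dot f g.
Proof. by rewrite !(dotC _ f) dotZl rmorphM. Qed.

Lemma dot0l f : dot 0 f = 0.
Proof. by rewrite -(scale0r f) dotZl mul0r. Qed.

Lemma dotBl f g h : dot (f - g) h = dot f h - dot g h.
Proof. by rewrite -scaleN1r dotDl dotZl mulN1r. Qed.

Lemma dot_suml I (r : seq I) (F : I -> ell2 R X) h :
  dot (\sum_(i <- r) F i) h = \sum_(i <- r) dot (F i) h.
Proof.
elim: r => [|i r IH]; first by rewrite !big_nil dot0l.
by rewrite !big_cons dotDl IH.
Qed.

Lemma dot_bound f g : cmod (dot f g) <= 2 * (norm2 f * norm2 g).
Proof.
apply: le_trans (csum_le (dot_summable f g)) _.
rewrite ler_wpM2l // -lee_fin fineK; last first.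
  by apply: esum_EFin_fin_num (dot_summable f g) => x; exact: cmod_ge0.
by apply: esum_le_seq => s us; exact: dot_le.
Qed.

Lemma dot_delta f x : dot f (delta x) = f x.
Proof.
rewrite /dot (@csum_finite _ _ _ [:: x]) //.
  by rewrite big_seq1 deltaE eqxx rmorph1 mulr1.
by move=> y; rewrite inE deltaE => /negbTE ->; rewrite rmorph0 mulr0.
Qed.

Lemma delta_dot f x : dot (delta x) f = (f x)^*.
Proof. by rewrite dotC dot_delta. Qed.

Lemma dot_norm f : dot f f = `|f| ^+ 2.
Proof.
have H x : f x * (f x)^* = (cmod (f x) ^+ 2)%:C%C.
  by rewrite -normCK -cmodE rmorphXn.
rewrite norm2E -rmorphXn norm2sq /dot /csum.
apply/eqP; rewrite eq_complex /=; apply/andP; split; apply/eqP.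
  transitivity (rsum (fun x => cmod (f x) ^+ 2)).
    by congr rsum; apply/funext => x; rewrite H.
  by rewrite rsum_ge0 // => [x|]; [exact: sqr_ge0|exact: ell2_sqsummable].
transitivity (rsum (fun _ : X => 0 : R)).
  by congr rsum; apply/funext => x; rewrite H.
by rewrite (@rsum_finite _ _ _ [::]) // big_nil.
Qed.

End inner_product.

Section bounded_operators.
Context {R : realType}.

Record bounded_op (X Y : choiceType) := BoundedOp {
  bounded_op_fun :> {linear ell2 R X -> ell2 R Y};
  bounded_op_continuous : continuous bounded_op_fun }.

Section adjoint.
Context {X Y : choiceType} (A : bounded_op X Y).

Lemma bounded_norm2 :
  exists2 M, 0 <= M & forall f, norm2 (A f) <= M * norm2 f.
Proof.
have /linear_boundedP := (linear_bounded_continuous A).2 (@bounded_op_continuous _ _ A).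
move=> /pinfty_ex_gt0 [r r0 H]; exists (complex.Re r).
  by move: r0; rewrite ltcE => /andP[_ /ltW].
move=> f; have := H f; rewrite !norm2E -[r]RRe_real ?gtr0_real // -rmorphM lecR.
by [].
Qed.

(* Forced by <A^* g, delta x> = <g, A (delta x)>; see [adjointE]. *)
Definition adjoint_fun (g : ell2 R Y) : X -> R[i] :=
  fun x => (dot (A (delta x)) g)^*.

Let adjoint_trunc g s : uniq s ->
  (norm2 (trunc (adjoint_fun g) s) ^+ 2)%:C%C =
    dot (A (trunc (adjoint_fun g) s)) g.
Proof.
move=> us; rewrite norm2_trunc // /trunc linear_sum dot_suml rmorph_sum.
apply: eq_bigr => x _; rewrite linearZ /= dotZl.
rewrite rmorphXn /= cmodE normCK; congr (_ * _).
by rewrite conjCK.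
Qed.

Let adjoint_bound : exists2 M, 0 <= M &
  forall g, adjoint_fun g \in sqsummable /\
    fine (sqsum (adjoint_fun g)) <= (M * norm2 g) ^+ 2.
Proof.
have [M M0 HM] := bounded_norm2; exists (2 * M); first by rewrite mulr_ge0.
move=> g; apply: sqsum_le => s us; rewrite -norm2_trunc //.
set h := trunc _ _; rewrite ler_pXn2r ?nnegrE ?mulr_ge0 ?norm2_ge0 //.
have : norm2 h ^+ 2 <= 2 * (M * norm2 h * norm2 g).
  have -> : norm2 h ^+ 2 = cmod (dot (A h) g).
    rewrite -adjoint_trunc //; apply: complexI; rewrite cmodE ger0_norm //.
    by rewrite ler0c sqr_ge0.
  apply: le_trans (dot_bound _ _) _.
  by rewrite ler_wpM2l // ler_wpM2r ?norm2_ge0.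
have [->|h0] := eqVneq (norm2 h) 0; first by rewrite !mulr_ge0 ?norm2_ge0.
have hp : 0 < norm2 h by rewrite lt_neqAle eq_sym h0 norm2_ge0.
rewrite (_ : 2 * _ = norm2 h * (2 * M * norm2 g)); last by ring.
by rewrite expr2 ler_pM2l.
Qed.

Fact adjoint_sqsummable g : adjoint_fun g \in sqsummable.
Proof. by have [M _ /(_ g)[]] := adjoint_bound. Qed.

Definition adjoint_map g : ell2 R X :=
  Ell2 (adjoint_fun g) (adjoint_sqsummable g).

Fact adjoint_is_linear : linear adjoint_map.
Proof.
move=> c f g; apply: ell2P => x; rewrite ell2D ell2Z /= /adjoint_fun.
by rewrite dotDr dotZr rmorphD rmorphM /= conjCK.
Qed.

HB.instance Definition _ := GRing.isLinear.Build _ _ _ _ adjoint_map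
  adjoint_is_linear.

Fact adjoint_continuous : continuous adjoint_map.
Proof.
apply/linear_bounded_continuous/linear_boundedP.
have [M M0 H] := adjoint_bound.
have MR : M%:C%C \is Num.real by rewrite ger0_real // ler0c.
near=> r => g.
apply: le_trans (_ : M%:C%C * `|g| <= _).
  rewrite !norm2E -rmorphM lecR.
  rewrite -(@ler_pXn2r _ 2) ?nnegrE ?mulr_ge0 ?norm2_ge0 // norm2sq.
  exact: (H g).2.
apply: ler_wpM2r; first exact: normr_ge0.
by near: r; exact: nbhs_pinfty_ge.
Unshelve. all: by end_near. Qed.

Definition adjoint : bounded_op Y X := BoundedOp adjoint_continuous.

Lemma adjointE f g : dot (A f) g = dot f (adjoint g).
Proof.
have T s : uniq s -> dot (A (trunc f s)) g = dot (trunc f s) (adjoint g).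
  move=> us; rewrite /trunc linear_sum !dot_suml; apply: eq_bigr => x _.
  by rewrite linearZ /= !dotZl delta_dot /= /adjoint_fun conjCK.
apply/eqP; rewrite -subr_eq0; apply/eqP/cmod0_eq0/eqP.
rewrite eq_le cmod_ge0 andbT; apply/ler_addgt0Pl => e e0; rewrite addr0.
have [M M0 HM] := bounded_norm2.
set K := 2 * (M * norm2 g + norm2 (adjoint g)) + 1.
have K0 : 0 < K.
  by rewrite ltr_wpDl // mulr_ge0 // addr_ge0 ?mulr_ge0 ?norm2_ge0.
have [s us Hs] := trunc_approx f (divr_gt0 e0 K0).
set d := f - trunc f s in Hs.
have -> : dot (A f) g - dot f (adjoint g) = dot (A d) g - dot d (adjoint g).
  by rewrite /d linearB !dotBl T //; ring.
apply: le_trans (cmodD _ _) _.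
rewrite -[- dot _ _]mulN1r cmodM (_ : cmod (- 1) = 1); last first.
  by apply: complexI; rewrite cmodE normrN normr1.
rewrite mul1r; apply: le_trans (lerD (dot_bound _ _) (dot_bound _ _)) _.
apply: le_trans (_ : K * norm2 d <= _); last first.
  by rewrite mulrC -ler_pdivlMr.
have h1 : norm2 (A d) * norm2 g <= M * norm2 d * norm2 g.
  by rewrite ler_wpM2r ?norm2_ge0.
have h2 := norm2_ge0 d; rewrite /K; lra.
Qed.

End adjoint.
End bounded_operators.

Arguments bounded_op R X%_type Y%_type : clear implicits.

Section dilations.
Context {R : realType} {L : finType}.

Definition row_coisometry (X : choiceType) (T : L -> bounded_op R X X) :=
  forall f, \sum_(l : L) T l (adjoint (T l) f) = f.

Definition linear_span (E : lmodType R[i]) (A : set E) : set E :=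
  [set v | exists n (a : 'I_n -> R[i]) (u : 'I_n -> E),
     (forall k, A (u k)) /\ v = \sum_(k < n) a k *: u k].

Definition cuntz_family (Y : choiceType) (S : L -> bounded_op R Y Y) :=
  (forall l l' f, adjoint (S l) (S l' f) = if l == l' then f else 0) /\
  (forall f, \sum_(l : L) S l (adjoint (S l) f) = f).

(* [incl] is the isometric inclusion of the small space in the large one; its
   range is the subspace K of the large space. *)
Definition cuntz_dilation (X Y : choiceType) (incl : ell2 R X -> ell2 R Y)
    (T : L -> bounded_op R X X) (S : L -> bounded_op R Y Y) :=
  [/\ cuntz_family S,
      forall l, adjoint (S l) @` range incl `<=` range incl,
      forall l f, adjoint (S l) (incl f) = incl (adjoint (T l) f) &
      closure (linear_span [set g | exists (s : seq L) (f : ell2 R X),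
                 g = foldr (fun l h => S l h) (incl f) s]) = [set: ell2 R Y]].

End dilations.

Section words.
Variable N : nat.

(* The default 1 makes the empty word admissible. *)
Definition no_trailing0 (s : seq 'I_N) : bool :=
  last 1%N [seq nat_of_ord k | k <- s] != 0%N.

Record word := Word { word_seq :> seq 'I_N; _ : no_trailing0 word_seq }.

HB.instance Definition _ := [isSub for word_seq].
HB.instance Definition _ := [Countable of word by <:].

Definition empty_word : word := Word (isT : no_trailing0 [::]).

(* For an admissible [w], the sequence [k :: w] is inadmissible only for
   [k = 0] and [w] empty, where the default implements 0 empty = empty. *)
Definition word_cons (k : 'I_N) (w : word) : word :=
  insubd empty_word (k :: word_seq w).

(* [None] is the null vector index. *)
Definition word_del (k : 'I_N) (w : word) : option word :=
  match word_seq w with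
  | [::] => if nat_of_ord k == 0%N then Some empty_word else None
  | k' :: s => if k' == k then insub s else None
  end.

Lemma no_trailing0_cons (k : 'I_N) s :
  no_trailing0 (k :: s) = if s is [::] then nat_of_ord k != 0%N else no_trailing0 s.
Proof. by case: s. Qed.

Lemma word_cons_empty (k : 'I_N) :
  nat_of_ord k = 0%N -> word_cons k empty_word = empty_word.
Proof.
by move=> k0; rewrite /word_cons /insubd insubF // no_trailing0_cons /= k0.
Qed.

Lemma word_consE (k : 'I_N) (w : word) :
  nat_of_ord k != 0%N \/ w <> empty_word -> word_cons k w = k :: w :> seq 'I_N.
Proof.
move=> kw; rewrite /word_cons insubdK // -topredE /= no_trailing0_cons.
case: w kw => [[|k' s] ws] /= kw //.
by case: kw => // -[]; exact: val_inj.
Qed.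

Lemma word_delP (k : 'I_N) (w w' : word) :
  word_del k w = Some w' <-> w = word_cons k w'.
Proof.
split.
  rewrite /word_del; case: w => [[|k' s] ws] /=.
    case: eqP => // k0 [<-]; rewrite word_cons_empty //; exact: val_inj.
  case: eqP => // k'k; subst k'; case: insubP => // u _ us [uw'].
  subst u; apply: val_inj; rewrite /= -us word_consE //.
  have [k0|] := eqVneq (nat_of_ord k) 0%N; [right => we|by left].
  by move: ws; rewrite -us we no_trailing0_cons /= k0.
move=> ->; have [[k0 ->]|kw] : (nat_of_ord k = 0%N /\ w' = empty_word) \/
    (nat_of_ord k != 0%N \/ w' <> empty_word).
- have [k0|k0] := eqVneq (nat_of_ord k) 0%N; last by right; left.
  by have [->|/eqP w0] := eqVneq w' empty_word; [left|right; right].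
- by rewrite word_cons_empty // /word_del /= k0.
rewrite /word_del (word_consE kw) eqxx; case: w' {kw} => s ws.
by rewrite insubT.
Qed.

End words.

Section inclusion.
Context {R : realType} {V : choiceType} {N : nat}.

Let word_incl_fun (f : V -> R[i]) : V * word N -> R[i] :=
  fun p => if p.2 == empty_word N then f p.1 else 0.

Fact word_incl_sqsummable (f : ell2 R V) : word_incl_fun f \in sqsummable.
Proof.
apply: (sqsum_le (M := norm2 f ^+ 2) _).1 => s us.
pose t := [seq p <- s | p.2 == empty_word N].
apply: le_trans (_ : \sum_(p <- t) cmod (f p.1) ^+ 2 <= _).
  rewrite big_filter [leRHS]big_mkcond; apply: ler_sum => p _.
  by rewrite /word_incl_fun; case: ifP => // _; rewrite cmod0 expr0n.
rewrite -(big_map fst xpredT (fun i => cmod (f i) ^+ 2)) norm2_seq //.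
rewrite map_inj_in_uniq ?filter_uniq // => -[i v] [j w].
by rewrite !mem_filter /= => /andP[/eqP-> _] /andP[/eqP-> _] ->.
Qed.

Definition word_incl (f : ell2 R V) : ell2 R (V * word N) :=
  Ell2 (word_incl_fun f) (word_incl_sqsummable f).

Lemma word_incl_delta (i : V) : word_incl (delta i) = delta (i, empty_word N).
Proof.
apply: ell2P => -[j w]; rewrite deltaE xpair_eqE /= /word_incl_fun /=.
by case: (w == _); rewrite ?andbT ?andbF.
Qed.

Fact word_incl_is_linear : linear word_incl.
Proof.
move=> c f g; apply: ell2P => -[i w].
rewrite -[RHS]/(c * word_incl f (i, w) + word_incl g (i, w)) /= /word_incl_fun /=; case: ifP => _; first by [].
by rewrite mulr0 addr0.
Qed.

HB.instance Definition _ := GRing.isLinear.Build _ _ _ _ word_incl word_incl_is_linear.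

Lemma word_incl_norm f : `|word_incl f| = `|f|.
Proof.
rewrite !norm2E; congr (_%:C)%C; apply/eqP; rewrite eq_le; apply/andP; split.
  apply: norm2_le (norm2_ge0 _) _ => s us.
  pose t := [seq p <- s | p.2 == empty_word N].
  apply: le_trans (_ : \sum_(p <- t) cmod (f p.1) ^+ 2 <= _).
    rewrite big_filter [leRHS]big_mkcond; apply: ler_sum => p _.
    by rewrite /= /word_incl_fun; case: ifP => // _; rewrite cmod0 expr0n.
  rewrite -(big_map fst xpredT (fun i => cmod (f i) ^+ 2)) norm2_seq //.
  rewrite map_inj_in_uniq ?filter_uniq // => -[i v] [j w].
  by rewrite !mem_filter /= => /andP[/eqP-> _] /andP[/eqP-> _] ->.
apply: norm2_le (norm2_ge0 _) _ => s us.
have us' : uniq [seq (i, empty_word N) | i <- s].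
  by rewrite map_inj_uniq // => i j [].
apply: le_trans (norm2_seq (word_incl f) us'); rewrite big_map.
by apply: ler_sum => i _; rewrite /= /word_incl_fun eqxx.
Qed.

End inclusion.

(* Distinct edges leaving a vertex have distinct labels, so an edge is
   determined by its source, label and target, and the graph is encoded by a
   ternary relation. *)
Record random_walk (R : realType) (V : countType) (L : finType) := RandomWalk {
  edge : V -> L -> V -> Prop;
  edge_out : forall i l j l' j', edge i l j -> edge i l' j' ->
    (l, j) <> (l', j') -> l <> l' /\ j <> j';
  edge_in : forall i i' l j, edge i l j -> edge i' l j -> i = i';
  weight : V -> L -> R[i];
  weight_no_edge : forall i l, ~ (exists j, edge i l j) -> weight i l = 0;
  weight_norm : forall i, \sum_(l : L) `|weight i l| ^+ 2 = 1 }.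

Section walk.
Context {R : realType} {V : countType} {L : finType} (W : random_walk R V L).

Definition out_labels (i : V) : {set L} := [set l | `[< exists j, edge W i l j >]]%SET.
Definition in_labels (j : V) : {set L} := [set l | `[< exists i, edge W i l j >]]%SET.
Definition n_out (i : V) : nat := #|out_labels i|.
Definition n_in (j : V) : nat := #|in_labels j|.

(* Only the entries [c l k] with [l] in [out_labels i] and [k < n_out i] are
   relevant; [enum_val] lists the labels leaving [i]. *)
Definition unitary_completion (i : V) (c : L -> nat -> R[i]) :=
  \matrix_(a < #|out_labels i|, k < #|out_labels i|) c (enum_val a) k
    \is unitarymx
  /\ (forall l, l \in out_labels i -> c l 0%N = weight W i l).

Definition walk_coisometry (T : L -> bounded_op R V V) :=
  forall l i,
    (forall j, edge W i l j -> adjoint (T l) (delta i) = weight W i l *: delta j) /\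
    (~ (exists j, edge W i l j) -> adjoint (T l) (delta i) = 0).

Section words_of_walk.
Variable N : nat.

Definition missing_labels : set (V * L) := [set p | p.2 \notin in_labels p.1].

Definition free_digits : set (V * 'I_N) := [set p : V * 'I_N | (n_out p.1 <= p.2)%N].

(* [delta_opt j None] is the vector (j, null). *)
Definition delta_opt (j : V) (o : option (word N)) : ell2 R (V * word N) :=
  if o is Some w then delta (j, w) else 0.

Definition dilation_formula (c : V -> L -> nat -> R[i])
    (phi : V * L -> V * 'I_N)
    (S : L -> bounded_op R (V * word N) (V * word N)) :=
  forall l j w,
    (forall i, edge W i l j ->
       S l (delta (j, w)) =
         \sum_(k < N | (k < n_out i)%N) (c i l k)^* *: delta (i, word_cons k w)) /\
    (~ (exists i, edge W i l j) ->
       S l (delta (j, w)) =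
         delta ((phi (j, l)).1, word_cons (phi (j, l)).2 w)).

(* The condition "l is the second component of psi (i, k')" presupposes that
   (i, k') is in the domain of psi. It can hold while an edge labeled l leaves
   i, and it then takes precedence: (i, k'w) is the image under S_l of
   ((psi (i, k')).1, w), whereas the sum over k < n_out i vanishes. *)
Definition adjoint_formula (c : V -> L -> nat -> R[i])
    (psi : V * 'I_N -> V * L)
    (S : L -> bounded_op R (V * word N) (V * word N)) :=
  forall l i (k' : 'I_N) w,
    let relabeled := free_digits (i, k') /\ l = (psi (i, k')).2 in
    [/\ relabeled ->
          adjoint (S l) (delta (i, word_cons k' w)) = delta ((psi (i, k')).1, w),
        forall j, edge W i l j -> ~ relabeled ->
          adjoint (S l) (delta (i, word_cons k' w)) =
            \sum_(k < N | (k < n_out i)%N)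
              c i l k *: delta_opt j (word_del k (word_cons k' w)) &
        ~ (exists j, edge W i l j) -> ~ relabeled ->
          adjoint (S l) (delta (i, word_cons k' w)) = 0].

End words_of_walk.
End walk.

(* Main.v *)
(* Let sigma_l send (i, kw) to (j, w) if k < n_i and i -> j with label l, and to
   (first component of psi (i, k), w) if n_i <= k. The values of S_l f are those
   of f composed with sigma_l, weighted by numbers of modulus at most 1, and the
   fibres of sigma_l have at most N points, so S_l is bounded. The Cuntz relations
   then reduce, on the digits k < n_i, to the orthogonality of the rows and of the
   columns of C_i, and on the digits k >= n_i to the bijectivity of phi.
   On K, only the digit 0 survives and c_{i,l}^0 is the weight, so S_l^* extends
   V_l^*. Finally S_l^* maps a basis vector (i, kw) with kw nonempty to a multiple
   of a basis vector with a shorter word, so x = sum_l S_l S_l^* x puts every basis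
   vector in the span of the orbit of K, by induction on the length. *)

Require Import Defs.
From HB Require Import structures.
From mathcomp Require Import all_boot all_order all_algebra.
From mathcomp Require Import complex.
From mathcomp Require Import all_classical all_reals all_analysis.

Set Implicit Arguments.
Unset Strict Implicit.
Unset Printing Implicit Defensive.

Import Order.TTheory GRing.Theory Num.Theory numFieldNormedType.Exports.

Local Open Scope classical_set_scope.
Local Open Scope ring_scope.

Section filtered_sums.
Context {R : realType} {X : choiceType} {I : Type}.
Implicit Types (r : seq I) (P : pred I) (F : I -> ell2 R X).

Lemma ell2_sum_cond r P F x :
  (\sum_(i <- r | P i) F i) x = \sum_(i <- r | P i) F i x.
Proof. by rewrite -big_filter ell2_sum big_filter. Qed.

Lemma dot_suml_cond r P F h :
  dot (\sum_(i <- r | P i) F i) h = \sum_(i <- r | P i) dot (F i) h.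
Proof. by rewrite -big_filter dot_suml big_filter. Qed.

End filtered_sums.

(** * Bounded operators: extensionality on the basis, weighted compositions *)

Section bounded_operator_lemmas.
Context {R : realType} {X Y : choiceType}.

Lemma adjoint_at (A : bounded_op R X Y) g x :
  adjoint A g x = (dot (A (delta x)) g)^*.
Proof. by []. Qed.

(** The coordinate [A f y] is the inner product of [f] with the adjoint at [delta y], which is
    computed from the vectors [A (delta x)] alone. *)
Lemma bounded_op_eq (A B : bounded_op R X Y) :
  (forall x, A (delta x) = B (delta x)) -> A = B.
Proof.
move=> AB; have {}AB : bounded_op_fun A =1 bounded_op_fun B.
  move=> f; apply: ell2P => y; rewrite -!dot_delta !adjointE; congr dot.
  by apply: ell2P => x; rewrite !adjoint_at AB.
case: A B AB => [A cA] [B cB] /= AB.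
(* Equal functions give equal records, since the linearity axioms and the continuity proof are
   propositions. *)
have {}AB : A = B.
  case: A B AB {cA cB} => [A mA] [B mB] /= /funext AB; subst B.
  case: mA mB => [[a1] [a2]] [[b1] [b2]].
  by rewrite (Prop_irrelevance a1 b1) (Prop_irrelevance a2 b2).
by subst B; congr BoundedOp; exact: Prop_irrelevance.
Qed.

Lemma bounded_op_of_norm2_le (A : {linear ell2 R X -> ell2 R Y}) (M : R) :
  (forall f, norm2 (A f) <= M * norm2 f) -> continuous A.
Proof.
move=> AM; apply/linear_bounded_continuous/linear_boundedP.
have MR : M%:C%C \is Num.real by apply/complex_realP; exists M.
near=> r => f.
apply: le_trans (_ : M%:C%C * `|f| <= _); first by rewrite !norm2E -rmorphM lecR.
apply: ler_wpM2r; first exact: normr_ge0.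
by near: r; exact: nbhs_pinfty_ge.
Unshelve. all: by end_near. Qed.

(* The label [t] makes the fibres of [s] on the support of [a] finite, with at
   most #|K| points. *)
Lemma weighted_composition (K : finType) (a : Y -> R[i]) (s : Y -> X)
    (t : Y -> K) :
  (forall y, cmod (a y) <= 1) ->
  (forall y y', a y != 0 -> a y' != 0 -> s y = s y' -> t y = t y' -> y = y') ->
  exists A : bounded_op R X Y, forall f y, A f y = a y * f (s y).
Proof.
move=> a1 inj_st; pose F (f : ell2 R X) := fun y => a y * f (s y).
pose M : R := #|K|%:R.
have F_le f r : uniq r ->
    \sum_(y <- r) cmod (F f y) ^+ 2 <= M * norm2 f ^+ 2.
  move=> ur.
  apply: le_trans (_ : \sum_(y <- r | a y != 0) cmod (f (s y)) ^+ 2 <= _).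
    rewrite [leRHS]big_mkcond; apply: ler_sum => y _; rewrite /F.
    case: eqP => [->|_] /=; first by rewrite mul0r cmod0 expr0n.
    rewrite cmodM exprMn ler_piMl ?sqr_ge0 //.
    by rewrite -(expr1n _ 2) ler_pXn2r ?nnegrE ?cmod_ge0.
  (* On the support, [s] is injective on each class of equal label, so a class contributes at most
     the square of [norm2 f]. *)
  rewrite (partition_big t xpredT) //= /M mulr_natl -sumr_const.
  apply: ler_sum => k _.
  rewrite -big_filter -(big_map s xpredT (fun x => cmod (f x) ^+ 2)).
  apply: norm2_seq; rewrite map_inj_in_uniq ?filter_uniq // => y y'.
  rewrite !mem_filter => /andP[/andP[ay /eqP tk] _] /andP[/andP[ay' /eqP tk'] _].
  by move=> ss; apply: inj_st => //; rewrite tk.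
have FX f : F f \in sqsummable by exact: (sqsum_le (F_le f)).1.
pose A0 f := Ell2 (F f) (FX f).
have A0_lin : linear A0.
  move=> x f g; apply: ell2P => y; rewrite ell2D ell2Z /= /F ell2D ell2Z.
  by rewrite mulrDr mulrCA.
pose Alin : {linear _ -> _} := HB.pack A0 (GRing.isLinear.Build _ _ _ _ A0 A0_lin).
have A_le f : norm2 (Alin f) <= Num.sqrt M * norm2 f.
  apply: norm2_le => [|r ur]; first by rewrite mulr_ge0 ?sqrtr_ge0 ?norm2_ge0.
  by rewrite exprMn sqr_sqrtr ?ler0n //; exact: F_le.
by exists (BoundedOp (bounded_op_of_norm2_le A_le)).
Qed.

End bounded_operator_lemmas.

(** * Density and linear spans *)

Lemma dense_of_deltas (R : realType) (X : choiceType) (D : set (ell2 R X)) :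
  (forall b s, D (trunc b s)) -> closure D = [set: ell2 R X].
Proof.
move=> HD; apply/seteqP; split=> // f _ B.
rewrite -filter_from_norm_nbhs => -[e /= e0 He].
(* The radius lives in [R[i]] but is real, being positive. Halving it turns the weak inequality of
   [trunc_approx] into the strict one of a ball. *)
have eE : e = (complex.Re e)%:C%C by rewrite RRe_real // gtr0_real.
have e'0 : 0 < complex.Re e by rewrite -ltcR -eE.
have [s us fs] := trunc_approx f (divr_gt0 e'0 (ltr0n R 2)).
exists (trunc f s); split; first exact: HD.
apply: He; rewrite /= norm2E eE ltcR; apply: le_lt_trans fs _.
by rewrite ltr_pdivrMr // ltr_pMr // ltr1n.
Qed.

Section linear_span_lemmas.
Context {R : realType} {E : lmodType R[i]} (A : set E).

Lemma linear_span_mem u : A u -> linear_span A u.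
Proof.
move=> Au; exists 1%N, (fun=> 1), (fun=> u).
by split=> //; rewrite big_ord1 scale1r.
Qed.

Lemma linear_span0 : linear_span A 0.
Proof.
exists 0%N, (fun=> 0), (fun=> 0); split; first by case.
by rewrite big_ord0.
Qed.

Lemma linear_span_sum I (r : seq I) (F : I -> E) :
  (forall i, linear_span A (F i)) -> linear_span A (\sum_(i <- r) F i).
Proof.
move=> FA; elim: r => [|i r [n [a [u [uA ru]]]]].
  by rewrite big_nil; exact: linear_span0.
have [m [b [v [vA iv]]]] := FA i.
pose glue T (x : 'I_m -> T) (y : 'I_n -> T) (k : 'I_(m + n)) :=
  match fintype.split k with inl k => x k | inr k => y k end.
exists (m + n)%N, (glue _ b a), (glue _ v u); split.
  by move=> k; rewrite /glue; case: (fintype.split k).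
rewrite big_cons ru iv big_split_ord /=; congr (_ + _); apply: eq_bigr => k _.
  by rewrite /glue -[lshift _ _]/(unsplit (inl k)) unsplitK.
by rewrite /glue -[rshift _ _]/(unsplit (inr k)) unsplitK.
Qed.

Lemma linear_spanZ x u : linear_span A u -> linear_span A (x *: u).
Proof.
move=> [n [a [v [vA ->]]]]; exists n, (fun k => x * a k), v; split=> //.
by rewrite scaler_sumr; apply: eq_bigr => k _; rewrite scalerA.
Qed.

Lemma linear_span_image (f : {linear E -> E}) u :
  (forall v, A v -> A (f v)) -> linear_span A u -> linear_span A (f u).
Proof.
move=> fA [n [a [v [vA ->]]]]; exists n, a, (fun k => f (v k)).
split; first by move=> k; exact: fA.
by rewrite linear_sum; apply: eq_bigr => k _; rewrite linearZ.
Qed.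

End linear_span_lemmas.

(** * Unique decomposition of a word into first digit and rest *)

Section word_decomposition.
Context {N : nat} (N_gt0 : (0 < N)%N).

(** The default digit 0 reads the empty word as 0 before the empty word, so that every word has a
    first digit. *)
Definition word_head (v : word N) : 'I_N := head (Ordinal N_gt0) v.

(** The default of [odflt] is never reached: deleting the head always succeeds, as the proof of
    [word_consK] shows. *)
Definition word_tail (v : word N) : word N :=
  odflt (empty_word N) (word_del (word_head v) v).

(** If the deletion succeeds, the word starts with both digits. Only 0 before the empty word fails
    to be a literal list cons, hence its separate treatment on either side. *)
Lemma word_del_cons (k k' : 'I_N) w :
  word_del k (word_cons k' w) = if k == k' then Some w else None.
Proof.
case: eqP => [->|kk']; first exact/word_delP.
case E: word_del => [u|] //; move/word_delP: E => E; exfalso; apply: kk'.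
have [[k0 w0]|kw] := pselect (nat_of_ord k' = 0%N /\ w = empty_word N).
  move: E; rewrite w0 word_cons_empty // => E.
  apply: val_inj; rewrite /= k0.
  have [//|k1] := eqVneq (nat_of_ord k) 0%N.
  by move/(congr1 (@word_seq N)): E; rewrite word_consE //; left.
move/(congr1 (@word_seq N)): E; rewrite word_consE; last first.
  have [k0|] := eqVneq (nat_of_ord k') 0%N; [right => w0|by left].
  exact: kw.
have [[k0 u0]|ku] := pselect (nat_of_ord k = 0%N /\ u = empty_word N).
  by rewrite u0 word_cons_empty.
rewrite word_consE => [[->]//|].
by have [k0|] := eqVneq (nat_of_ord k) 0%N; [right => u0; exact: ku|left].
Qed.

Lemma word_consK (v : word N) : word_cons (word_head v) (word_tail v) = v.
Proof.
suff : word_del (word_head v) v != None.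
  by rewrite /word_tail; case E: word_del => [w|] // _; move/word_delP: E.
case: v => [[|k s] ks]; rewrite /word_del /word_head //= eqxx insubT //.
by move: ks; rewrite no_trailing0_cons; case: s.
Qed.

Lemma word_cons_head (k : 'I_N) w : word_head (word_cons k w) = k.
Proof.
by have /word_delP := word_consK (word_cons k w); rewrite word_del_cons; case: eqP.
Qed.

Lemma word_cons_tail (k : 'I_N) w : word_tail (word_cons k w) = w.
Proof. by rewrite /word_tail word_cons_head word_del_cons eqxx. Qed.

Lemma word_cons_inj (k k' : 'I_N) w w' :
  word_cons k w = word_cons k' w' -> k = k' /\ w = w'.
Proof.
by move=> E; rewrite -(word_cons_head k w) -{2}(word_cons_tail k w) E
  word_cons_head word_cons_tail.
Qed.

(** Only the empty word, read as 0 before itself, does not get shorter. The strict decrease drives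
    the induction of [span_orbit_delta]. *)
Lemma size_word_tail (v : word N) :
  v != empty_word N -> (size (word_tail v) < size v)%N.
Proof.
move=> v0; rewrite -[in X in (_ < X)%N](word_consK v) word_consE //.
have [k0|] := eqVneq (nat_of_ord (word_head v)) 0%N; [right => w0|by left].
by move/eqP: v0; apply; rewrite -(word_consK v) w0 word_cons_empty.
Qed.

Lemma word_cons_eq_empty (k : 'I_N) w :
  (word_cons k w == empty_word N) = (nat_of_ord k == 0%N) && (w == empty_word N).
Proof.
apply/eqP/andP => [E|[/eqP k0 /eqP->]]; last exact: word_cons_empty.
have E0 : word_cons (Ordinal N_gt0) (empty_word N) = empty_word N.
  exact: word_cons_empty.
by move: E; rewrite -[in RHS]E0 => /word_cons_inj[-> ->].
Qed.

Lemma vertex_word_eq (V : eqType) (i i' : V) (k k' : 'I_N) w w' :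
  ((i, word_cons k w) == (i', word_cons k' w')) = [&& i == i', k == k' & w == w'].
Proof.
apply/eqP/and3P => [[-> /word_cons_inj[-> ->]]|[/eqP-> /eqP-> /eqP->]] //.
Qed.

End word_decomposition.

Lemma word_inclE (R : realType) (V : choiceType) (N : nat) (f : ell2 R V) i
    (w : word N) :
  word_incl f (i, w) = if w == empty_word N then f i else 0.
Proof. by []. Qed.


(** * The graph and its row coisometry *)

Section walk_lemmas.
Context {R : realType} {V : countType} {L : finType} (W : random_walk R V L).

(** Made total by the junk value [i]; its uses are guarded by [out_labels] or by a vanishing
    coefficient. *)
Definition target (i : V) (l : L) : V := xget i [set j | edge W i l j].

Lemma out_labelsP i l : reflect (exists j, edge W i l j) (l \in out_labels W i).
Proof. by rewrite inE; exact: asboolP. Qed.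

Lemma in_labelsP j l : reflect (exists i, edge W i l j) (l \in in_labels W j).
Proof. by rewrite inE; exact: asboolP. Qed.

Lemma edge_target i l : l \in out_labels W i -> edge W i l (target i l).
Proof. by move=> /out_labelsP il; exact: (xgetPex i il). Qed.

Lemma edge_targetE i l j : edge W i l j -> target i l = j.
Proof.
move=> ilj; have il : l \in out_labels W i by apply/out_labelsP; exists j.
apply: contrapT => tj.
have /(edge_out (edge_target il) ilj)[//] : (l, target i l) <> (l, j) by case.
Qed.

Lemma edge_out_labels i l j : edge W i l j -> l \in out_labels W i.
Proof. by move=> ilj; apply/out_labelsP; exists j. Qed.

(** A vertex without outgoing edges would have all weights zero, against the normalization. This
    makes 0 a column index of every [C_i]. *)
Lemma n_out_gt0 i : (0 < n_out W i)%N.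
Proof.
rewrite /n_out card_gt0; apply/eqP => out0.
have : \sum_(l : L) `|weight W i l| ^+ 2 = 0.
  apply: big1 => l _; rewrite weight_no_edge ?normr0 ?expr0n //.
  by move/out_labelsP; rewrite out0 inE.
by rewrite weight_norm => /eqP; rewrite oner_eq0.
Qed.

Lemma weight_le1 i l : cmod (weight W i l) <= 1.
Proof.
rewrite -(@ler_pXn2r _ 2) ?nnegrE ?cmod_ge0 // expr1n -lecR rmorphXn /= cmodE.
by rewrite rmorph1 -(weight_norm W i) (bigD1 l) //= lerDl sumr_ge0.
Qed.

Lemma out_weight i l : l \notin out_labels W i -> weight W i l = 0.
Proof. by move=> il; apply: weight_no_edge => /out_labelsP; exact/negP. Qed.

Section coisometry.
Context (T : L -> bounded_op R V V).
(** These are the coordinates that the prescribed adjoints on basis vectors force by duality. *)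
Hypothesis TE : forall l f i, T l f i = (weight W i l)^* * f (target i l).

Lemma coisometry_adjoint_delta l i :
  adjoint (T l) (delta i) = weight W i l *: delta (target i l).
Proof.
apply: ell2P => j; rewrite adjoint_at dot_delta TE ell2Z !deltaE eq_sym.
by rewrite rmorphM /= conjCK conjC_nat.
Qed.

Lemma walk_coisometry_of_formula : walk_coisometry W T.
Proof.
move=> l i; rewrite coisometry_adjoint_delta; split=> [j /edge_targetE ->//|il].
by rewrite weight_no_edge // scale0r.
Qed.

(** By [edge_in], no other vertex has an edge labeled [l] into [j], so [T l (delta j)] is a multiple
    of [delta i]. *)
Lemma coisometry_adjoint_edge l i j f :
  edge W i l j -> adjoint (T l) f j = weight W i l * f i.
Proof.
move=> ilj; rewrite adjoint_at.
suff -> : T l (delta j) = (weight W i l)^* *: delta i.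
  by rewrite dotZl delta_dot rmorphM /= !conjCK.
apply: ell2P => i'; rewrite TE ell2Z !deltaE; have [->|ii'] := eqVneq i' i.
  by rewrite (edge_targetE ilj) eqxx.
have [il'|/out_weight ->] := boolP (l \in out_labels W i'); last first.
  by rewrite rmorph0 mul0r mulr0.
rewrite (_ : _ == _ = false) ?mulr0 //; apply: contra_neqF ii' => /eqP tj.
by apply: (edge_in (l := l) (j := j)) ilj; rewrite -tj; exact: edge_target.
Qed.

Lemma coisometry_adjoint_no_edge l j f :
  l \notin in_labels W j -> adjoint (T l) f j = 0.
Proof.
move=> jl; rewrite adjoint_at (_ : T l (delta j) = 0).
  by rewrite dot0l rmorph0.
apply: ell2P => i; rewrite TE deltaE.
have [il|/out_weight ->] := boolP (l \in out_labels W i); last first.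
  by rewrite rmorph0 mul0r.
rewrite (_ : _ == _ = false) ?mulr0 //; apply: contraNF jl => /eqP <-.
by apply/in_labelsP; exists i; exact: edge_target.
Qed.

Lemma row_coisometry_of_formula : row_coisometry T.
Proof.
move=> f; apply: ell2P => i; rewrite ell2_sum.
rewrite (eq_bigr (fun l => `|weight W i l| ^+ 2 * f i)).
  by rewrite -mulr_suml weight_norm mul1r.
move=> l _; rewrite TE normCK.
have [il|/out_weight ->] := boolP (l \in out_labels W i).
  by rewrite (coisometry_adjoint_edge f (edge_target il)) mulrCA mulrA.
by rewrite rmorph0 !mul0r.
Qed.

End coisometry.

Lemma walk_coisometry_exists : exists T : L -> bounded_op R V V,
  forall l f i, T l f i = (weight W i l)^* * f (target i l).
Proof.
suff /choice[T TE] : forall l, exists A : bounded_op R V V,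
    forall f i, A f i = (weight W i l)^* * f (target i l) by exists T.
(* A constant label suffices: where the weight is nonzero, [edge_in] makes the passage to the target
   injective. *)
move=> l; apply: (weighted_composition (t := fun=> tt)) => [i|i i' wi wi' tt' _].
  by rewrite cmod_conj weight_le1.
have out k : (weight W k l)^* != 0 -> edge W k l (target k l).
  rewrite conjC_eq0 => wk; apply: edge_target; apply: contraNT wk => /out_weight ->.
  by rewrite eqxx.
apply: (edge_in (l := l) (j := target i l)); first exact: out.
by rewrite tt'; exact: out.
Qed.

Lemma walk_coisometry_unique (T T' : L -> bounded_op R V V) :
  walk_coisometry W T -> walk_coisometry W T' -> T = T'.
Proof.
move=> HT HT'; apply/funext => l; apply: bounded_op_eq => j.
apply: ell2P => i; rewrite -!dot_delta !adjointE; congr dot.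
have [[T1 T2] [T'1 T'2]] := (HT l i, HT' l i).
have [[k ilk]|il] := pselect (exists k, edge W i l k).
  by rewrite (T1 _ ilk) (T'1 _ ilk).
by rewrite T2 // T'2.
Qed.

End walk_lemmas.

(** * Orthogonality relations of the matrices [C_i] *)

Section unitarity.
Context {R : realType} {V : countType} {L : finType} (W : random_walk R V L).
Context {i : V} {c : L -> nat -> R[i]} (hc : unitary_completion W i c).

Let M := \matrix_(a < #|out_labels W i|, k < #|out_labels W i|) c (enum_val a) k.

Let M_unitary : M \is unitarymx. Proof. by case: hc. Qed.

Lemma completion_rows l l' : l \in out_labels W i -> l' \in out_labels W i ->
  \sum_(k < n_out W i) c l k * (c l' k)^* = (l == l')%:R.
Proof.
move=> il il'; have /unitarymxP/matrixP := M_unitary.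
move=> /(_ (enum_rank_in il l) (enum_rank_in il l')).
rewrite !mxE (inj_in_eq (can_in_inj (enum_rankK_in il))) // => <-.
by apply: eq_bigr => k _; rewrite !mxE !enum_rankK_in.
Qed.

(** [unitarymx] gives orthonormal rows; for a square matrix a right inverse is also a left
    inverse. *)
Lemma completion_cols (k k' : nat) : (k < n_out W i)%N -> (k' < n_out W i)%N ->
  \sum_(l in out_labels W i) (c l k)^* * c l k' = (k == k')%:R.
Proof.
move=> ki k'i; have /unitarymxP/mulmx1C/matrixP := M_unitary.
move=> /(_ (Ordinal ki) (Ordinal k'i)); rewrite !mxE -val_eqE /= => <-.
by rewrite big_enum_val; apply: eq_bigr => a _; rewrite !mxE.
Qed.

Lemma completion_le1 l (k : nat) : l \in out_labels W i -> (k < n_out W i)%N ->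
  cmod (c l k) <= 1.
Proof.
move=> il ki; rewrite -(@ler_pXn2r _ 2) ?nnegrE ?cmod_ge0 // expr1n -lecR.
rewrite rmorphXn /= cmodE rmorph1.
have <- : \sum_(k < n_out W i) c l k * (c l k)^* = 1.
  by rewrite completion_rows // eqxx.
rewrite (bigD1 (Ordinal ki)) //= normCK lerDl sumr_ge0 // => k' _.
by rewrite -normCK exprn_ge0.
Qed.

End unitarity.

(** * Construction of the dilation *)

Section dilation.
Context {R : realType} {N : nat} {V : countType} {L : finType}.
Context (W : random_walk R V L) (c : V -> L -> nat -> R[i]).
Context (phi : V * L -> V * 'I_N) (psi : V * 'I_N -> V * L).
Hypotheses (N_gt0 : (0 < N)%N) (card_labels : #|L| = N).
Hypothesis hc : forall i, unitary_completion W i (c i).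
Hypothesis phi_bij : set_bij (missing_labels W) (free_digits W (N := N)) phi.
Hypothesis phiK : {in missing_labels W, cancel phi psi}.

Lemma n_out_le i : (n_out W i <= N)%N.
Proof. by rewrite -card_labels max_card. Qed.

Lemma phi_free j l : l \notin in_labels W j ->
  (n_out W (phi (j, l)).1 <= (phi (j, l)).2)%N.
Proof. by case: phi_bij => phi_fun _ _ jl; exact: (phi_fun (j, l)). Qed.

Lemma psi_phi j l : l \notin in_labels W j -> psi (phi (j, l)) = (j, l).
Proof. by move=> jl; apply: phiK; rewrite inE. Qed.

Lemma free_digitP i (k : 'I_N) : (n_out W i <= k)%N ->
  exists2 p, p.2 \notin in_labels W p.1 & phi p = (i, k).
Proof. by case: phi_bij => _ _ + ik => /(_ (i, k) ik)[p pm <-]; exists p. Qed.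

Lemma psi_missing i (k : 'I_N) : (n_out W i <= k)%N ->
  (psi (i, k)).2 \notin in_labels W (psi (i, k)).1.
Proof. by move=> /free_digitP[[j l] jl <-]; rewrite psi_phi. Qed.

Lemma phi_psi i (k : 'I_N) : (n_out W i <= k)%N -> phi (psi (i, k)) = (i, k).
Proof. by move=> /free_digitP[[j l] jl <-]; rewrite psi_phi. Qed.

(* Every basis vector is [(i, word_cons k w)] for unique [i], [k] and [w], and the
   value of [S l f] there is forced by the adjoint formula. *)
Definition pointwise_dilation (S : L -> bounded_op R (V * word N) (V * word N)) :=
  forall l f i (k : 'I_N) w, S l f (i, word_cons k w) =
    if (k < n_out W i)%N then
      if l \in out_labels W i then (c i l k)^* * f (target W i l, w) else 0
    else if l == (psi (i, k)).2 then f ((psi (i, k)).1, w) else 0.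

(** The first digit serves as label: with the image point it recovers the vertex, and the tail of
    the word is part of the image point. *)
Lemma pointwise_dilation_exists : exists S, pointwise_dilation S.
Proof.
pose hd (p : V * word N) : 'I_N := word_head N_gt0 p.2.
pose tl (p : V * word N) : word N := word_tail N_gt0 p.2.
pose a l p : R[i] :=
  if (hd p < n_out W p.1)%N then
    if l \in out_labels W p.1 then (c p.1 l (hd p))^* else 0
  else (l == (psi (p.1, hd p)).2)%:R.
pose s l p : V * word N :=
  (if (hd p < n_out W p.1)%N then target W p.1 l else (psi (p.1, hd p)).1, tl p).
suff /choice[S SE] : forall l, exists A : bounded_op R (V * word N) (V * word N),
    forall f p, A f p = a l p * f (s l p).
  exists S => l f i k w; rewrite SE /a /s /hd /tl /=.
  rewrite word_cons_head word_cons_tail; case: ifP => _.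
    by case: ifP => // _; rewrite mul0r.
  by case: eqP => _; rewrite ?mul1r ?mul0r.
move=> l; apply: (weighted_composition (t := hd)) => [[i v]|].
  rewrite /a /=; case: ifP => [ki|_].
    by case: ifP => [il|_]; rewrite ?cmod0 ?ler01 // cmod_conj (completion_le1 (hc i)).
  by case: eqP => _; rewrite ?cmod0 ?cmod1 ?ler01.
have low i v : (hd (i, v) < n_out W i)%N -> a l (i, v) != 0 ->
    edge W i l (s l (i, v)).1.
  rewrite /a /s /= => ->; case: ifP => [il _|]; last by rewrite eqxx.
  exact: edge_target.
have high i v : (n_out W i <= hd (i, v))%N -> a l (i, v) != 0 ->
    phi ((s l (i, v)).1, l) = (i, hd (i, v)) /\
    l \notin in_labels W (s l (i, v)).1.
  rewrite /a /s /= ltnNge => ik; rewrite ik /=.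
  case: (l =P _) => [->|_]; last by rewrite eqxx.
  by rewrite -surjective_pairing phi_psi // psi_missing.
move=> [i v] [i' v'] ai ai' ss hh.
suff ii' : i = i'.
  congr (_, _) => //; rewrite -(word_consK N_gt0 v) -(word_consK N_gt0 v').
  by case: ss => _; rewrite /tl /= => ->; move: hh; rewrite /hd /= => ->.
(* The common digit can be low (below the out-degree) for one vertex and high for the other. Two low
   digits are settled by [edge_in], two high ones by [phi]; in the mixed cases [l] would both enter
   and miss the same vertex. *)
have [ki|ik] := ltnP (hd (i, v)) (n_out W i);
    have [ki'|ik'] := ltnP (hd (i', v')) (n_out W i').
- have e' := low _ _ ki' ai'; rewrite -ss in e'.
  exact: edge_in (low _ _ ki ai) e'.
- have [_] := high _ _ ik' ai'; rewrite -ss => /in_labelsP[].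
  by exists i; exact: low.
- have [_] := high _ _ ik ai; rewrite ss => /in_labelsP[].
  by exists i'; exact: low.
- have [+ _] := high _ _ ik' ai'; rewrite -ss (high _ _ ik ai).1.
  by case.
Qed.

Lemma sum_completion (E : nmodType) i (F : nat -> E) :
  \sum_(k < N | (k < n_out W i)%N) F k = \sum_(k < n_out W i) F k.
Proof. by rewrite -big_ord_widen // n_out_le. Qed.

Lemma dilation_formula_unique (S S' : L -> bounded_op R (V * word N) (V * word N)) :
  dilation_formula W c phi S -> dilation_formula W c phi S' -> S = S'.
Proof.
move=> HS HS'; apply/funext => l; apply: bounded_op_eq => -[j w].
have [[S1 S2] [S'1 S'2]] := (HS l j w, HS' l j w).
have [[i ilj]|lj] := pselect (exists i, edge W i l j).
  by rewrite (S1 _ ilj) (S'1 _ ilj).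
by rewrite S2 // S'2.
Qed.

(** * The two formulas and the Cuntz relations *)

Section cuntz.
Context (S : L -> bounded_op R (V * word N) (V * word N)).
Hypothesis SE : pointwise_dilation S.

Lemma dilation_eq (f g : ell2 R (V * word N)) :
  (forall i (k : 'I_N) w, f (i, word_cons k w) = g (i, word_cons k w)) -> f = g.
Proof. by move=> fg; apply: ell2P => -[i v]; rewrite -(word_consK N_gt0 v) fg. Qed.

(** A low digit at another vertex would give a second edge labeled [l] into [j]; a high digit
    anywhere would make [l] missing at [j]. Only low digits at [i] remain. *)
Lemma dilation_edge i l j w : edge W i l j -> S l (delta (j, w)) =
  \sum_(k < N | (k < n_out W i)%N) (c i l k)^* *: delta (i, word_cons k w).
Proof.
move=> ilj; apply: dilation_eq => i' k v; rewrite SE ell2_sum_cond.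
under eq_bigr do rewrite ell2Z deltaE (vertex_word_eq N_gt0).
have [E|ii'] := eqVneq i' i; last first.
  rewrite big1 ?mulr0 // => [|k' _]; last by rewrite mulr0.
  case: ltnP => ki'.
    case: ifP => // il'; rewrite deltaE xpair_eqE (_ : target _ _ _ == _ = false).
      by rewrite mulr0.
    apply: contra_neqF ii' => /eqP tj; apply: edge_in ilj.
    by rewrite -tj; exact: edge_target.
  case: eqP => // lE; rewrite deltaE xpair_eqE (_ : _ == j = false) //.
  apply/eqP => jE; move: (psi_missing ki'); rewrite -lE jE => /in_labelsP[].
  by exists i.
subst i'; case: ltnP => ki.
  rewrite (edge_out_labels ilj) (edge_targetE ilj) deltaE xpair_eqE eqxx /=.
  rewrite (bigD1 k) //= eqxx big1 ?addr0 // => k' /andP[_ /negbTE k'k].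
  by rewrite eq_sym k'k mulr0.
rewrite big1 => [|k' k'i].
  case: eqP => // lE; rewrite deltaE xpair_eqE (_ : _ == j = false) //.
  apply/eqP => jE; move: (psi_missing ki); rewrite -lE jE => /in_labelsP[].
  by exists i.
rewrite (_ : k == k' = false) ?mulr0 //; apply: contraTF k'i => /eqP <-.
by rewrite -leqNgt.
Qed.

(** Low digits give nothing, as no edge labeled [l] ends in [j]; at high digits,
    [psi (i, k) = (j, l)] means [(i, k) = phi (j, l)]. *)
Lemma dilation_missing l j w : l \notin in_labels W j ->
  S l (delta (j, w)) = delta ((phi (j, l)).1, word_cons (phi (j, l)).2 w).
Proof.
move=> jl; apply: dilation_eq => i k v; rewrite SE [RHS]deltaE (vertex_word_eq N_gt0).
have pf := phi_free jl; have pK := psi_phi jl.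
case: ltnP => ki.
  rewrite (_ : [&& _, _ & _] = false).
    case: ifP => // il; rewrite deltaE xpair_eqE (_ : _ == j = false) ?mulr0 //.
    apply: contraNF jl => /eqP <-; apply/in_labelsP; exists i; exact: edge_target.
  apply: contraTF ki => /and3P[/eqP-> /eqP-> _]; by rewrite -leqNgt.
have -> : [&& i == (phi (j, l)).1, k == (phi (j, l)).2 & v == w] =
    (psi (i, k) == (j, l)) && (v == w).
  rewrite andbA -xpair_eqE -surjective_pairing; congr (_ && _).
  by apply/eqP/eqP => [->//|<-]; rewrite phi_psi.
case: (psi (i, k)) => j' l' /=; rewrite !xpair_eqE [l == l']eq_sym.
by case: (l' == l); rewrite ?andbT ?andbF.
Qed.

Lemma dilation_formula_of_pointwise : dilation_formula W c phi S.
Proof.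
move=> l j w; split=> [i|lj]; first exact: dilation_edge.
by apply: dilation_missing; apply/in_labelsP.
Qed.

Lemma dilation_adjoint_edge l i j f w : edge W i l j ->
  adjoint (S l) f (j, w) =
    \sum_(k < N | (k < n_out W i)%N) c i l k * f (i, word_cons k w).
Proof.
move=> ilj; rewrite adjoint_at (dilation_edge w ilj) dot_suml_cond rmorph_sum.
by apply: eq_bigr => k _; rewrite dotZl delta_dot rmorphM /= !conjCK.
Qed.

Lemma dilation_adjoint_missing l j f w : l \notin in_labels W j ->
  adjoint (S l) f (j, w) = f ((phi (j, l)).1, word_cons (phi (j, l)).2 w).
Proof. by move=> jl; rewrite adjoint_at dilation_missing // delta_dot conjCK. Qed.

Lemma dilation_adjoint_low l i (k : 'I_N) w : (k < n_out W i)%N ->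
  adjoint (S l) (delta (i, word_cons k w)) =
    if l \in out_labels W i then c i l k *: delta (target W i l, w) else 0.
Proof.
move=> ki; apply: ell2P => p; rewrite adjoint_at dot_delta SE ki.
case: ifP => _; last by rewrite conjC0 ell20.
by rewrite ell2Z !deltaE eq_sym rmorphM /= conjCK conjC_nat.
Qed.

Lemma dilation_adjoint_high l i (k : 'I_N) w : (n_out W i <= k)%N ->
  adjoint (S l) (delta (i, word_cons k w)) =
    if l == (psi (i, k)).2 then delta ((psi (i, k)).1, w) else 0.
Proof.
move=> ik; apply: ell2P => p; rewrite adjoint_at dot_delta SE ltnNge ik /=.
case: ifP => _; last by rewrite conjC0 ell20.
by rewrite !deltaE eq_sym conjC_nat.
Qed.

(** For a low digit [k'] only the term [k = k'] survives the deletion. For a high one no term does,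
    and both sides vanish outside the relabeled case. *)
Lemma adjoint_formula_of_pointwise : adjoint_formula W c psi S.
Proof.
move=> l i k' w /=; have [ki|ik] := ltnP k' (n_out W i).
  rewrite (dilation_adjoint_low l w ki).
  split=> [[]|j ilj _|il _].
  - by rewrite /free_digits /= leqNgt ki.
  - rewrite (edge_out_labels ilj) (edge_targetE ilj) (bigD1 k') //= big1.
      by rewrite word_del_cons // eqxx addr0.
    by move=> k /andP[_ /negbTE kk']; rewrite word_del_cons // kk' scaler0.
  - by case: out_labelsP.
rewrite (dilation_adjoint_high l w ik).
split=> [[_ ->]|j ilj nrel|il nrel]; first by rewrite eqxx.
  rewrite ifN; last by apply/eqP => lE; apply: nrel.
  rewrite big1 // => k ki; rewrite word_del_cons // (_ : k == k' = false) ?scaler0 //.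
  by apply: contraTF ki => /eqP ->; rewrite -leqNgt.
by rewrite ifN //; apply/eqP => lE; apply: nrel.
Qed.

(** The split is on whether [l] enters [j]. If so, from [i], rows [l] and [l'] of [C_i] are
    multiplied; if not, [phi (j, l)] carries a high digit, and [psi] sends it back to [(j, l)]. *)
Lemma dilation_orthogonal l l' f :
  adjoint (S l) (S l' f) = if l == l' then f else 0.
Proof.
apply: ell2P => -[j w]; have [jl|jl] := boolP (l \in in_labels W j).
  have [i ilj] := in_labelsP _ _ _ jl; have il := edge_out_labels ilj.
  rewrite (dilation_adjoint_edge _ _ ilj).
  rewrite (eq_bigr (fun k : 'I_N => if l' \in out_labels W i then
      c i l k * (c i l' k)^* * f (target W i l', w) else 0)); last first.
    by move=> k ki; rewrite SE ki; case: ifP => _; rewrite ?mulr0 // mulrA.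
  have [il'|il'] := boolP (l' \in out_labels W i); last first.
    (* All terms vanish, and [l] differs from [l'] because only [l] leaves [i]. *)
    by rewrite big1 //; case: eqP il' => // <-; rewrite il.
  rewrite -mulr_suml (sum_completion i (fun k => c i l k * (c i l' k)^*)).
  rewrite (completion_rows (hc i)) //; case: eqP => [<-|_]; last by rewrite mul0r.
  by rewrite mul1r (edge_targetE ilj).
rewrite dilation_adjoint_missing // SE ltnNge phi_free //=.
by rewrite -surjective_pairing psi_phi //= eq_sym; case: eqP.
Qed.

Lemma dilation_coisometric f : \sum_(l : L) S l (adjoint (S l) f) = f.
Proof.
apply: dilation_eq => i k w; rewrite ell2_sum.
have [ki|ik] := ltnP k (n_out W i).
  rewrite (eq_bigr (fun l => if l \in out_labels W i then
      \sum_(k' < N | (k' < n_out W i)%N)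
        (c i l k)^* * c i l k' * f (i, word_cons k' w) else 0)).
    (* Summing over the labels first produces inner products of columns [k] and [k'] of [C_i]. *)
    rewrite -big_mkcond exchange_big (bigD1 k) //= -mulr_suml.
    rewrite (completion_cols (hc i)) // eqxx mul1r big1 ?addr0 // => k' /andP[k'i].
    rewrite eq_sym -val_eqE -mulr_suml (completion_cols (hc i)) // => /negbTE ->.
    by rewrite mul0r.
  move=> l _; rewrite SE ki; case: ifP => // /edge_target il.
  rewrite (dilation_adjoint_edge _ _ il) mulr_sumr.
  by apply: eq_bigr => k' _; rewrite mulrA.
(* At a high digit a single label contributes, the one that [psi] assigns. *)
rewrite (eq_bigr (fun l =>
    if l == (psi (i, k)).2 then f (i, word_cons k w) else 0)).
  by rewrite -big_mkcond big_pred1_eq.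
move=> l _; rewrite SE ifN -?leqNgt //; case: eqP => // ->.
by rewrite dilation_adjoint_missing ?psi_missing // -surjective_pairing phi_psi.
Qed.

Lemma cuntz_family_of_pointwise : cuntz_family S.
Proof. by split; [exact: dilation_orthogonal|exact: dilation_coisometric]. Qed.

(** * The subspace K and its cyclicity *)

Section inclusion.
Context (T : L -> bounded_op R V V).
Hypothesis TE : forall l f i, T l f i = (weight W i l)^* * f (target W i l).

(** Vectors of K live on the empty word, which [kw] equals only for [k = 0] and [w] empty; the
    surviving coefficient, from column 0, is the weight. *)
Lemma dilation_adjoint_incl l f :
  adjoint (S l) (word_incl f) = word_incl (adjoint (T l) f).
Proof.
apply: ell2P => -[j w]; rewrite word_inclE.
have [jl|jl] := boolP (l \in in_labels W j).
  have [i ilj] := in_labelsP _ _ _ jl.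
  rewrite (dilation_adjoint_edge _ _ ilj) (coisometry_adjoint_edge TE _ ilj).
  under eq_bigr do rewrite word_inclE (word_cons_eq_empty N_gt0).
  rewrite (bigD1 (Ordinal N_gt0)) /= ?n_out_gt0 // big1 => [|k /andP[_ k0]].
    rewrite addr0 (hc i).2 ?(edge_out_labels ilj) //.
    by case: ifP => _; rewrite ?mulr0.
  by rewrite -val_eqE /= in k0; rewrite (negbTE k0) mulr0.
(* The digit given by [phi] is at least [n_out], hence positive, so the new word is never empty. *)
rewrite dilation_adjoint_missing // (coisometry_adjoint_no_edge TE) //.
rewrite word_inclE (word_cons_eq_empty N_gt0) if_same eqn0Ngt.
by rewrite (leq_trans (n_out_gt0 W _) (phi_free jl)).
Qed.

Let orbit := [set g | exists (s : seq L) (f : ell2 R V),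
  g = foldr (fun l h => S l h) (word_incl f) s].

Lemma span_orbit_delta i v : linear_span orbit (delta (i, v)).
Proof.
have [n] := ubnP (size v); elim: n i v => // n IH i v vn.
have [->|v0] := eqVneq v (empty_word N).
  by apply: linear_span_mem; exists [::], (delta i); rewrite /= word_incl_delta.
(* The orbit is stable under each [S l], so only the adjoint images remain, and their words are
   shorter. *)
rewrite -(dilation_coisometric (delta (i, v))).
apply: linear_span_sum => l; apply: linear_span_image.
  by move=> _ [s [f ->]]; exists (l :: s), f.
have IHt j : linear_span orbit (delta (j, word_tail N_gt0 v)).
  by apply: IH; apply: leq_trans (size_word_tail N_gt0 v0) _.
rewrite -[v in delta (_, v)](word_consK N_gt0).
have [ki|ik] := ltnP (word_head N_gt0 v) (n_out W i).
  rewrite dilation_adjoint_low //; case: ifP => _; last exact: linear_span0.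
  exact: linear_spanZ.
by rewrite dilation_adjoint_high //; case: ifP => _ //; exact: linear_span0.
Qed.

Lemma cuntz_dilation_of_pointwise : cuntz_dilation (word_incl (N := N)) T S.
Proof.
split.
- exact: cuntz_family_of_pointwise.
- move=> l _ [_ [f _ <-] <-]; exists (adjoint (T l) f) => //.
  by rewrite dilation_adjoint_incl.
- exact: dilation_adjoint_incl.
apply: dense_of_deltas => b s; apply: linear_span_sum => -[i v].
by apply: linear_spanZ; exact: span_orbit_delta.
Qed.

End inclusion.
End cuntz.
End dilation.

Theorem theorem4p4 (R : realType) (N : nat) (V : countType) (L : finType)
    (hN : (2 <= N)%N) (hL : #|L| = N)
    (W : random_walk R V L)
    (hsum : (\esum_(i in [set: V]) ((N - n_out W i)%N%:R : R)%:E)%E =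
            (\esum_(j in [set: V]) ((N - n_in W j)%N%:R : R)%:E)%E)
    (c : V -> L -> nat -> R[i])
    (hc : forall i, unitary_completion W i (c i))
    (phi : V * L -> V * 'I_N) (psi : V * 'I_N -> V * L)
    (hphi : set_bij (missing_labels W) (free_digits W (N := N)) phi)
    (hpsi : {in missing_labels W, cancel phi psi}) :
  exists (T : L -> bounded_op R V V)
         (S : L -> bounded_op R (V * word N) (V * word N)),
    [/\ unique (walk_coisometry W) T,
        row_coisometry T,
        unique (dilation_formula W c phi) S,
        cuntz_dilation (word_incl (N := N)) T S &
        adjoint_formula W c psi S].
Proof.
have N_gt0 : (0 < N)%N by exact: ltnW.
(* Both families are built from their coordinates; the prescribed formulas follow, and each
   determines its family. *)
have [T TE] := walk_coisometry_exists W.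
have [S SE] := pointwise_dilation_exists N_gt0 hc hphi hpsi.
have HT := walk_coisometry_of_formula TE.
have HS := dilation_formula_of_pointwise N_gt0 hphi hpsi SE.
exists T, S; split.
- by split=> // T'; exact: walk_coisometry_unique.
- exact: row_coisometry_of_formula TE.
- by split=> // S'; exact: dilation_formula_unique.
- exact: (cuntz_dilation_of_pointwise N_gt0 hL hc hphi hpsi SE TE).
- exact: adjoint_formula_of_pointwise SE.
Qed.
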